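(* Let $K,H$ be Hilbert spaces (both real or both complex) with $K$ finite dimensional, and let $\mathcal{B}$ be the open unit ball of $L(K,H)$, with the metric $\rho$. Then any non-empty $m$-set in $\mathcal{B}$ either is a singleton or has a non-diametral point (with respect to $\rho$).
   Context: $L(K,H)$ is the Banach space of all bounded linear operators from $K$ to $H$ with the operator norm. For $A\in\mathcal{B}$ the Möbius transformation $M_A:\mathcal{B}\to\mathcal{B}$ is $$M_A(X)=(1-AA^* )^{-1/2}(A+X)(1+A^*X)^{-1}(1-A^*A)^{1/2};$$ it satisfies $M_A^{-1}=M_{-A}$. The metric $\rho$ on $\mathcal{B}$ is defined by $\rho(A,B)=\tanh^{-1}(\|M_{-A}(B)\|)$ (in the complex case it is the Carathéodory distance of $\mathcal{B}$). For $X,Y\in\mathcal{B}$, a midpoint for $(X,Y)$ is a point $Z\in\mathcal{B}$ with $\rho(Z,W)\le\frac12(\rho(X,W)+\rho(Y,W))$ for all $W\in\mathcal{B}$. A subset of $\mathcal{B}$ is mid-convex if with any two of its points it contains all of their midpoints. An $m$-set is a subset of $\mathcal{B}$ which is mid-convex and compact in the weak operator topology. A point $A$ of a $\rho$-bounded set $M$ is diametral if $\sup\{\rho(A,X):X\in M\}=\operatorname{diam} M$, where $\operatorname{diam} M=\sup\{\rho(X,Y):X,Y\in M\}$; otherwise it is non-diametral.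
   Formalization: Diametral points are defined only for ρ-bounded sets, but an m-set can be ρ-unbounded (then its diameter is undefined, or infinite with every point diametral); here every point of an unbounded m-set counts as non-diametral, so the claim has content for ρ-bounded m-sets. *)

(* Defs.v *)
From HB Require Import structures.
From mathcomp Require Import all_boot all_order all_algebra.
From mathcomp Require Import sesquilinear.
From mathcomp Require Import complex.
From mathcomp Require Import all_classical all_reals all_analysis.
From mathcomp Require Import ring lra.

Set Implicit Arguments.
Unset Strict Implicit.
Unset Printing Implicit Defensive.

Import Order.TTheory GRing.Theory Num.Theory.
Import numFieldNormedType.Exports.

Local Open Scope classical_set_scope.
Local Open Scope ring_scope.

(** The scalar field is [R] or [R[i]]; treating the two cases through one
    parameter makes the real and the complex theory literally the same text. *)
Variant scalar_kind := RealScalars | ComplexScalars.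

Definition scalar_field (R : realType) (k : scalar_kind) : numFieldType :=
  match k with RealScalars => R | ComplexScalars => R[i] end.

Definition sconj (R : realType) (k : scalar_kind) : scalar_field R k -> scalar_field R k :=
  match k with RealScalars => idfun | ComplexScalars => @conjc R end.

Definition sre (R : realType) (k : scalar_kind) : scalar_field R k -> R :=
  match k with RealScalars => idfun | ComplexScalars => @complex.Re R end.

Arguments sconj {R k}.
Arguments sre {R k}.

(** These instances make the theory of [sesquilinear] apply to [{dot V for sconj}]. *)
Lemma sconj_zmod_morphism R k : zmod_morphism (@sconj R k).
Proof. by case: k => // x y; rewrite /sconj rmorphB. Qed.

Lemma sconj_monoid_morphism R k : monoid_morphism (@sconj R k).
Proof. by case: k => //=; split=> [|x y]; rewrite ?rmorph1 ?rmorphM. Qed.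

Lemma sconjK R k : involutive (@sconj R k).
Proof. by case: k => // x; exact: conjcK. Qed.

HB.instance Definition _ R k :=
  GRing.isZmodMorphism.Build (scalar_field R k) (scalar_field R k) sconj
    (@sconj_zmod_morphism R k).
HB.instance Definition _ R k :=
  GRing.isMonoidMorphism.Build (scalar_field R k) (scalar_field R k) sconj
    (@sconj_monoid_morphism R k).
HB.instance Definition _ R k :=
  isInvolutive.Build (scalar_field R k) sconj (@sconjK R k).

(** In [normedModType (scalar_field R k)] the norm takes its values in [scalar_field R k]. *)
HB.mixin Record isHilbert (R : realType) (k : scalar_kind) V
    of CompleteNormedModule (scalar_field R k) V := {
  inner : {dot V for @sconj R k} ;
  inner_norm : forall x : V, inner x x = `|x| ^+ 2 }.

#[short(type="hilbertType")]
HB.structure Definition Hilbert (R : realType) (k : scalar_kind) :=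
  { V of CompleteNormedModule (scalar_field R k) V & isHilbert R k V }.

#[short(type="finHilbertType")]
HB.structure Definition FinHilbert (R : realType) (k : scalar_kind) :=
  { V of Hilbert R k V & Vector (scalar_field R k) V }.

Section Operators.
Context {R : realType} {k : scalar_kind}.
Implicit Types U V : hilbertType R k.

Definition bounded_operator U V (A : U -> V) : Prop :=
  linear A /\ exists c : scalar_field R k, forall x, `|A x| <= c * `|x|.

Definition opnorm U V (A : U -> V) : R :=
  sup [set sre `|A x| | x in [set x : U | `|x| <= 1]].

(** The adjoint, the inverse and the positive square root are each unique when
    they exist; [get] picks them, and is junk otherwise. *)
Definition adjoint U V (A : U -> V) : V -> U :=
  get [set B | forall x y, inner (A x) y = inner x (B y)].

Definition inv_op V (T : V -> V) : V -> V :=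
  get [set S | [/\ bounded_operator S, cancel T S & cancel S T]].

(** Self-adjointness is automatic from positivity only over the complex field. *)
Definition positive_operator V (S : V -> V) : Prop :=
  [/\ bounded_operator S, forall x y, inner (S x) y = inner x (S y)
    & forall x, 0 <= inner (S x) x].

Definition sqrt_op V (T : V -> V) : V -> V :=
  get [set S | positive_operator S /\ S \o S = T].

(** The weak operator topology: the coarsest one for which every
    [A |-> <A x, y>] is continuous. It is put on all functions [U -> V]; compactness
    of a set of operators only involves the topology this induces on operators. *)
Definition matrix_coefficients U V (A : U -> V) : {ptws U * V -> scalar_field R k} :=
  fun p => inner (A p.1) p.2.

Definition weak_operator_topology U V : topologicalType :=
  initial_topology (@matrix_coefficients U V).

End Operators.

Definition tanh (R : realType) (x : R) : R :=
  (expR x - expR (- x)) / (expR x + expR (- x)).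

Definition atanh (R : realType) (x : R) : R := ln ((1 + x) / (1 - x)) / 2.

Lemma atanhK (R : realType) (x : R) : `|x| < 1 -> tanh (atanh x) = x.
Proof.
rewrite ltr_norml => /andP[x1 x2].
have p1 : 0 < 1 + x by lra.
have p2 : 0 < 1 - x by lra.
rewrite /tanh /atanh expRN.
set e := expR _.
have e0 : 0 < e by exact: expR_gt0.
have E : e ^+ 2 = (1 + x) / (1 - x).
  by rewrite /e -expRM_natl mulrC divfK ?pnatr_eq0// lnK// posrE divr_gt0.
have -> : (e - e^-1) / (e + e^-1) = (e ^+ 2 - 1) / (e ^+ 2 + 1).
  by field; rewrite ?gt_eqF//; nra.
by rewrite E; field; rewrite !gt_eqF//; lra.
Qed.

Lemma tanhK (R : realType) (y : R) : atanh (tanh y) = y.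
Proof.
rewrite /atanh /tanh expRN; set e := expR y.
have e0 : 0 < e by exact: expR_gt0.
have -> : (1 + (e - e^-1) / (e + e^-1)) / (1 - (e - e^-1) / (e + e^-1)) = e ^+ 2.
  by field; rewrite ?gt_eqF//; nra.
by rewrite lnXn// expRK mulr2n; field.
Qed.

Section OperatorBall.
Context {R : realType} {k : scalar_kind}.
Variables K H : hilbertType R k.
Implicit Types (A B X Y Z W : K -> H) (M : set (K -> H)).

Definition operator_ball : set (K -> H) :=
  [set A | bounded_operator A /\ opnorm A < 1].

Definition mobius A X : K -> H :=
  inv_op (sqrt_op (idfun \- (A \o adjoint A)))
    \o (A \+ X)
    \o inv_op (idfun \+ (adjoint A \o X))
    \o sqrt_op (idfun \- (adjoint A \o A)).

Definition rho A B : R := atanh (opnorm (mobius (\- A) B)).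

Definition is_midpoint X Y Z : Prop :=
  operator_ball Z /\
  forall W, operator_ball W -> rho Z W <= (rho X W + rho Y W) / 2.

Definition mid_convex M : Prop :=
  forall X Y Z, M X -> M Y -> is_midpoint X Y Z -> M Z.

Definition m_set M : Prop :=
  [/\ M `<=` operator_ball, mid_convex M
    & compact (M : set (weak_operator_topology K H))].

Definition rho_bounded M : Prop :=
  exists r : R, forall X Y, M X -> M Y -> rho X Y <= r.

Definition diam M : R := sup [set rho p.1 p.2 | p in M `*` M].

(** Diametrality is a notion for [rho]-bounded sets only, and an m-set need not be
    [rho]-bounded: for [K] one-dimensional, [H] = l^2 and [0 < a_n < 1] tending to [1],
    the sums [\sum_n l_n a_n e_n] with [l_n >= 0] and [\sum_n l_n <= 1] form an
    unbounded one. In an unbounded set no point is diametral. *)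
Definition diametral M A : Prop :=
  [/\ rho_bounded M, M A & sup [set rho A X | X in M] = diam M].

Definition non_diametral M A : Prop := M A /\ ~ diametral M A.

End OperatorBall.

(* Main.v *)
Require Import Defs.
From HB Require Import structures.
From mathcomp Require Import all_boot all_order all_algebra.
From mathcomp Require Import sesquilinear complex.
From mathcomp Require Import all_classical all_reals all_analysis.
From mathcomp Require Import ring lra.

Set Implicit Arguments.
Unset Strict Implicit.
Unset Printing Implicit Defensive.

Import Order.TTheory GRing.Theory Num.Theory.
Import numFieldNormedType.Exports.

Local Open Scope classical_set_scope.
Local Open Scope ring_scope.

(** Consider K x H with the indefinite form [(y, h), (y', h')] = <y, y'> - <h, h'>.
    An operator A is in the ball exactly when its graph is uniformly positive, and
    cosh (rho A B) is the supremum of the form on pairs of unit vectors of the graphs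
    of A and B ([rho_leP]). So rho is studied through graphs; Moebius transformations
    appear only in the proof of this formula ([mobius_factor]), which requires the
    square roots and inverses in their definition to exist ([sqrt_opP], [inv_opP]).

    Splitting K x H along a graph and its orthogonal complement gives the triangle
    inequality ([graph_triangle]) and, for any X and Y in the ball, an operator Z
    such that the reflection in the graph of Z exchanges the graphs of X and Y. Such a
    Z is a midpoint of (X, Y), because W and its mirror image W' satisfy
    2 rho(Z, W) = rho(W, W') <= rho(W, Y) + rho(Y, W') = rho(W, Y) + rho(X, W)
    ([reflection_midpoint], [midpoint_exists]).

    Now let every point of M be diametral, with d = diam M > 0 finite. Given X, Y in M
    with midpoint Z, a point of M at distance almost d from Z is at distance almost
    d from both X and Y. Hence some ultrafilter U on M is asymptotically at distance d
    from each point of M. Let A in M be its weak limit. As K is finite dimensional, the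
    forms <X x, X x'> also converge along U, uniformly for x, x' in the unit ball, and
    so do <X x, C x'> to <A x, C x'> for each fixed C. Two terms X, Y chosen
    successively along U then pair like A with itself: with q = cosh d, Q the form of
    the graph of A and g the limit of the squared lengths, Q <= q g. The unit
    vectors of the graph of the midpoint Z of X and Y are normalized sums of vectors
    of equal length g(x) = g(z), whose pairing Q(x, z) is at least g(x); as
    Q(x + z) <= 2 q g(x) + 2 Q(x, z), while the sum has squared length
    2 g(x) + 2 Q(x, z), their pairings with a unit vector of a further term W are
    at most the square root of q (q + 1) / 2, up to small errors. This is smaller
    than q ([midpoint_closer]), so Z stays at distance less than d from W,
    a contradiction ([not_all_diametral]). *)

(** * Scalars *)

Section Scalars.
Context {R : realType} {k : scalar_kind}.
Local Notation F := (scalar_field R k).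

Definition remb : R -> F :=
  match k return R -> scalar_field R k with
  | RealScalars => idfun | ComplexScalars => real_complex R end.

Lemma sreD (x y : F) : sre (x + y) = sre x + sre y.
Proof. by move: x y; case: k => //= -[a b] [c d]. Qed.

Lemma sreN (x : F) : sre (- x) = - sre x.
Proof. by move: x; case: k => //= -[a b]. Qed.

Lemma sre0 : sre (0 : F) = 0.
Proof. by case: k. Qed.

Lemma sreM_remb r (x : F) : sre (remb r * x) = r * sre x.
Proof. by move: x; rewrite /remb; case: k => //= -[a b] /=; ring. Qed.

Lemma sre_remb r : sre (remb r) = r.
Proof. by rewrite /remb; case: k. Qed.

Lemma rembD r s : remb (r + s) = remb r + remb s.
Proof. by rewrite /remb; case: k => //; rewrite rmorphD. Qed.

Lemma rembM r s : remb (r * s) = remb r * remb s.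
Proof. by rewrite /remb; case: k => //; rewrite rmorphM. Qed.

Lemma remb1 : remb 1 = 1.
Proof. by rewrite /remb; case: k. Qed.

Lemma remb0 : remb 0 = 0.
Proof. by rewrite /remb; case: k. Qed.

Lemma rembN r : remb (- r) = - remb r.
Proof. by apply/eqP; rewrite -addr_eq0 -rembD addNr remb0. Qed.

Lemma ler_remb r s : (remb r <= remb s) = (r <= s).
Proof. by rewrite /remb; case: k => //=; rewrite lecR. Qed.

Lemma ltr_remb r s : (remb r < remb s) = (r < s).
Proof. by rewrite /remb; case: k => //=; rewrite ltcR. Qed.

Lemma sreK (x : F) : 0 <= x -> remb (sre x) = x.
Proof.
move: x; rewrite /remb; case: k => //= -[a b]; rewrite lecE /= => /andP[/eqP -> _] //.
Qed.

Lemma sre_conj (x : F) : sre (sconj x) = sre x.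
Proof. by move: x; case: k => //= -[a b]. Qed.

Lemma sconj_fixed (x : F) : sconj x = x -> x = remb (sre x).
Proof.
move: x; rewrite /remb; case: k => //= -[a b] /= [] /eqP.
by rewrite eq_sym -subr_eq0 opprK -mulr2n mulrn_eq0 /= => /eqP ->.
Qed.

Lemma sconj_remb r : sconj (remb r) = remb r :> F.
Proof. by rewrite /remb; case: k => //=; rewrite oppr0. Qed.

Lemma sre_le_norm (x : F) : `|sre x| <= sre `|x|.
Proof.
move: x; case: k => //= x; have := normc_ge_Re x.
by rewrite lecE => /andP[_] /=.
Qed.

Lemma sre_norm_ge0 (x : F) : 0 <= sre `|x|.
Proof. by rewrite -ler_remb sreK // remb0. Qed.

Lemma sre_conjM (x : F) : sre (sconj x * x) = (sre `|x|) ^+ 2.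
Proof.
have -> : sconj x * x = `|x| * `|x|.
  move: x; case: k => /= x.
    by change (x * x = `|x : R| * `|x : R|); rewrite -!expr2 real_normK ?num_real.
  by rewrite mulrC -sqr_normc expr2.
by rewrite -{1}(@sreK `|x|) // sreM_remb expr2.
Qed.

Lemma sre_norm_remb r : sre `|remb r : F| = `|r|.
Proof.
have [r0|r0] := leP 0 r.
  by rewrite !ger0_norm -?remb0 ?ler_remb // sre_remb.
by rewrite !ltr0_norm -?remb0 ?ltr_remb // -rembN sre_remb.
Qed.

Lemma sre_mono (x y : F) : x <= y -> sre x <= sre y.
Proof.
by move=> xy; rewrite -subr_ge0 -sreN -sreD -ler_remb remb0 sreK subr_ge0.
Qed.

Lemma sreM_eq0 (z : F) : (forall a, sre (a * z) = 0) -> z = 0.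
Proof.
move=> /(_ (sconj z)); rewrite sre_conjM => /eqP.
rewrite sqrf_eq0 => /eqP z0; apply/eqP.
by rewrite -normr_eq0 -(@sreK `|z|) // z0 remb0.
Qed.

(** A single second real direction: together with 1 it spans the scalars over
    the reals, whichever the kind. *)
Definition iunit : F :=
  match k return scalar_field R k with
  | RealScalars => 0 | ComplexScalars => 'i%C end.

Lemma scalarE (z : F) : exists s : R, z = remb (sre z) + remb s * iunit /\ `|s| <= sre `|z|.
Proof.
move: z; rewrite /remb /iunit; case: k => /= [z|z].
  by exists 0; rewrite mul0r addr0 normr0 /sre normr_ge0.
exists (complex.Im z); split; first by rewrite {1}[z]complexE [_ * 'i%C]mulrC.
case: z => a b /=.
by rewrite /Normc.normc -sqrtr_sqr ler_wsqrtr // lerDr sqr_ge0.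
Qed.
End Scalars.

(** The Cauchy-Schwarz inequality, read off the discriminant: in this form it
    applies to every nonnegative quadratic form below, whatever its vectors. *)
Lemma quadratic_CS (R : realType) (a b c : R) : 0 <= a -> 0 <= b ->
  (forall r, 0 <= r ^+ 2 * a + 2 * r * c + b) -> `|c| <= Num.sqrt a * Num.sqrt b.
Proof.
move=> a0 b0 pos; rewrite -sqrtrM // -sqrtr_sqr ler_sqrt ?mulr_ge0 //.
case: (eqVneq a 0) => [a_0|an0].
  have [->|cn0] := eqVneq c 0; first by rewrite expr0n mulr_ge0.
  have := pos (- (b + 1) / (2 * c)).
  have -> : (- (b + 1) / (2 * c)) ^+ 2 * a + 2 * (- (b + 1) / (2 * c)) * c + b = - 1.
    by rewrite a_0; field.
  by rewrite lerNr oppr0 ler10.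
have A0 : 0 < a by rewrite lt0r an0.
have := pos (- c / a).
have -> : (- c / a) ^+ 2 * a + 2 * (- c / a) * c + b = b - c ^+ 2 / a by field.
by rewrite subr_ge0 ler_pdivrMr // mulrC.
Qed.

(** * The underlying real inner product space *)

Section RealStructure.
Context {R : realType} {k : scalar_kind}.
Local Notation F := (scalar_field R k).
Section One.
Context {V : hilbertType R k}.
Implicit Types x y z : V.

(** The norm takes its values in the scalars and the inner product is complex in
    general, but operator norms and rho only see real parts: a supremum of real
    parts over complex subspaces equals the supremum of moduli. All estimates are
    therefore made with [ip] and [nrm], which take values in R. *)
Definition nrm x : R := sre `|x|.
Definition ip x y : R := sre (inner x y).

Lemma nrm_ge0 x : 0 <= nrm x.
Proof. by rewrite -(@ler_remb R k) sreK // remb0. Qed.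

Lemma rembnrm x : remb (nrm x) = `|x|.
Proof. exact: sreK. Qed.

Lemma nrmD x y : nrm (x + y) <= nrm x + nrm y.
Proof. by rewrite -(@ler_remb R k) rembD !rembnrm ler_normD. Qed.

Lemma nrmZ a x : nrm (a *: x) = sre `|a| * nrm x.
Proof. by rewrite /nrm normrZ -(@sreK _ _ `|a|) // sreM_remb sre_remb. Qed.

Lemma nrmN x : nrm (- x) = nrm x.
Proof. by rewrite /nrm normrN. Qed.

Lemma nrm0 : nrm 0 = 0.
Proof. by rewrite /nrm normr0 sre0. Qed.

Lemma nrm_eq0 x : nrm x = 0 -> x = 0.
Proof. by move=> x0; apply/eqP; rewrite -normr_eq0 -rembnrm x0 remb0. Qed.

Lemma innerC x y : inner x y = sconj (inner y x).
Proof. by rewrite hermC expr0 mul1r. Qed.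

Lemma innerZl a x y : inner (a *: x) y = a * inner x y.
Proof. exact: linearZl_LR. Qed.

Lemma innerZr a x y : inner x (a *: y) = sconj a * inner x y.
Proof. by rewrite innerC innerZl rmorphM [inner x y]innerC. Qed.

Lemma innerDl x y z : inner (x + y) z = inner x z + inner y z.
Proof. exact: linearDl. Qed.

Lemma innerDr x y z : inner z (x + y) = inner z x + inner z y.
Proof. exact: linearD. Qed.

Lemma inner0l z : inner 0 z = 0.
Proof. exact: linear0l. Qed.

Lemma inner0r z : inner z 0 = 0.
Proof. exact: linear0. Qed.

Lemma ipC x y : ip x y = ip y x.
Proof. by rewrite /ip innerC sre_conj. Qed.

Lemma ipDl x y z : ip (x + y) z = ip x z + ip y z.
Proof. by rewrite /ip linearDl /= sreD. Qed.

Lemma ipNl x z : ip (- x) z = - ip x z.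
Proof. by rewrite /ip linearNl sreN. Qed.

Lemma ipZl r x z : ip (remb r *: x) z = r * ip x z.
Proof. by rewrite /ip linearZl_LR /= sreM_remb. Qed.

Lemma ip0l z : ip 0 z = 0.
Proof. by rewrite /ip linear0l sre0. Qed.

Lemma ipDr x y z : ip z (x + y) = ip z x + ip z y.
Proof. by rewrite ipC ipDl !(ipC z). Qed.

Lemma ipNr x z : ip z (- x) = - ip z x.
Proof. by rewrite ipC ipNl (ipC z). Qed.

Lemma ipZr r x z : ip z (remb r *: x) = r * ip z x.
Proof. by rewrite ipC ipZl (ipC z). Qed.

Lemma ip0r z : ip z 0 = 0.
Proof. by rewrite ipC ip0l. Qed.

Lemma ipxx x : ip x x = nrm x ^+ 2.
Proof.
by rewrite /ip inner_norm -rembnrm expr2 -rembM sre_remb -expr2.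
Qed.

Lemma ip_norm x y : `|ip x y| <= nrm x * nrm y.
Proof.
have pos r : 0 <= r ^+ 2 * nrm x ^+ 2 + 2 * r * ip x y + nrm y ^+ 2.
  have := sqr_ge0 (nrm (remb r *: x + y)).
  rewrite -(ipxx (_ + _)) ipDl !ipDr !ipZl !ipZr.
  rewrite !ipxx (ipC y x).
  by congr (_ <= _); ring.
by have := quadratic_CS (sqr_ge0 _) (sqr_ge0 _) pos; rewrite !sqrtr_sqr !(ger0_norm (nrm_ge0 _)).
Qed.

Lemma ip_le x y : ip x y <= nrm x * nrm y.
Proof. exact: le_trans (ler_norm _) (ip_norm x y). Qed.

Lemma ip_eq0 x : (forall y, ip x y = 0) -> x = 0.
Proof. by move=> /(_ x); rewrite ipxx => /eqP; rewrite sqrf_eq0 => /eqP/nrm_eq0. Qed.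

Lemma ip_eq x y : (forall z, ip x z = ip y z) -> x = y.
Proof.
move=> h; apply/eqP; rewrite -subr_eq0; apply/eqP/ip_eq0 => z.
by rewrite ipDl ipNl h subrr.
Qed.

Lemma inner_norm_le x y : sre `|inner x y| <= nrm x * nrm y.
Proof.
set z := inner x y; case: (eqVneq (sre `|z|) 0) => [->|z0].
  by rewrite mulr_ge0 ?nrm_ge0.
have := ip_le (sconj z *: x) y; rewrite /ip innerZl -/z sre_conjM.
have -> : nrm (sconj z *: x) = sre `|z| * nrm x.
  rewrite nrmZ; congr (_ * _).
  apply/eqP; rewrite -(@eqrXn2 _ 2) ?sre_norm_ge0 // -!sre_conjM.
  by rewrite sconjK mulrC.
by rewrite expr2 -mulrA ler_pM2l // lt0r z0 sre_norm_ge0.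
Qed.

End One.

Section Lin.
Context {U V : lmodType F} (A : U -> V) (Al : linear A).

Lemma linD x y : A (x + y) = A x + A y.
Proof. by have := Al 1 x y; rewrite !scale1r. Qed.
Lemma lin0 : A 0 = 0.
Proof. by apply: (addrI (A 0)); rewrite -linD !addr0. Qed.
Lemma linZ a x : A (a *: x) = a *: A x.
Proof. by have := Al a x 0; rewrite lin0 !addr0. Qed.
Lemma linN x : A (- x) = - A x.
Proof. by rewrite -scaleN1r linZ scaleN1r. Qed.
Lemma linB x y : A (x - y) = A x - A y.
Proof. by rewrite linD linN. Qed.
End Lin.

Section Two.
Context {U V : hilbertType R k}.

(** Equality of real parts is enough, since x may be replaced by all its scalar
    multiples. *)
Lemma ip_inner (A : U -> V) (B : V -> U) : linear A ->
  (forall x y, ip (A x) y = ip x (B y)) -> forall x y, inner (A x) y = inner x (B y).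
Proof.
move=> Al AB x y; apply/eqP; rewrite -subr_eq0; apply/eqP; apply: sreM_eq0 => a.
rewrite mulrBr sreD sreN -[a * inner x _]linearZl_LR -[a * inner (A x) _]linearZl_LR /=.
by rewrite -(linZ Al); apply/eqP; rewrite subr_eq0; apply/eqP; exact: AB.
Qed.

Lemma boundedP (A : U -> V) : bounded_operator A <->
  linear A /\ exists c : R, 0 <= c /\ forall x, nrm (A x) <= c * nrm x.
Proof.
split=> -[Al [c cA]]; split=> //.
  exists `|sre c|; split=> // x.
  case: (eqVneq (nrm x) 0) => [/nrm_eq0 ->|x0]; first by rewrite (lin0 Al) !nrm0 mulr0.
  have : nrm (A x) <= sre c * nrm x.
    by rewrite mulrC -(@sreM_remb R k) rembnrm mulrC; exact: (sre_mono (cA x)).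
  move=> /le_trans; apply; rewrite ler_wpM2r ?nrm_ge0 //; exact: ler_norm.
exists (remb c) => x; rewrite -!rembnrm -rembM ler_remb; exact: cA.2.
Qed.

Lemma opnorm_le (A : U -> V) (t : R) : bounded_operator A -> 0 <= t ->
  opnorm A <= t <-> forall x, nrm (A x) <= t * nrm x.
Proof.
move=> /boundedP [Al [c [c0 cA]]] t0.
have le1 (x : U) : `|x| <= 1 -> nrm x <= 1.
  by rewrite -rembnrm -remb1 ler_remb.
pose S := [set sre `|A x| | x in [set x : U | `|x| <= 1]].
have S0 : S !=set0 by exists (sre `|A 0|); exists 0 => //=; rewrite normr0 ler01.
have Sub : ubound S c.
  move=> _ [x /le1 x1 <-]; apply: le_trans (cA x) _.
  by rewrite ler_piMr.
split=> [At x|At].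
  case: (eqVneq (nrm x) 0) => [/nrm_eq0 ->|x0]; first by rewrite (lin0 Al) !nrm0 mulr0.
  have x1 : 0 < nrm x by rewrite lt0r x0 nrm_ge0.
  have yE : nrm (remb (nrm x)^-1 *: x) = 1.
    by rewrite nrmZ sre_norm_remb ger0_norm ?invr_ge0 ?nrm_ge0 // mulVf.
  have : S (sre `|A (remb (nrm x)^-1 *: x)|).
    by exists (remb (nrm x)^-1 *: x) => //=; rewrite -rembnrm yE remb1.
  move=> /(ub_le_sup (ex_intro _ c Sub)) /le_trans /(_ At).
  rewrite (linZ Al) -/(nrm _) nrmZ sre_norm_remb ger0_norm ?invr_ge0 ?nrm_ge0 //.
  by rewrite mulrC ler_pdivrMr.
apply: ge_sup => // _ [x /le1 x1 <-]; apply: le_trans (At x) _.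
by rewrite ler_piMr.
Qed.

Lemma opnorm_ge0 (A : U -> V) : bounded_operator A -> 0 <= opnorm A.
Proof.
move=> /boundedP [Al [c [c0 cA]]]; apply: ub_le_sup.
  exists c => _ [x x1 <-]; apply: le_trans (cA x) _.
  by rewrite ler_piMr // -(@ler_remb R k) remb1 rembnrm.
by exists 0 => /=; rewrite ?(lin0 Al) ?normr0 ?sre0 ?ler01.
Qed.

Lemma ballP (A : U -> V) : operator_ball A <->
  linear A /\ exists t, [/\ 0 <= t, t < 1 & forall x, nrm (A x) <= t * nrm x].
Proof.
split=> [[Ab A1]|[Al [t [t0 t1 At]]]].
  split; first by case: Ab.
  exists (opnorm A); split=> //; first exact: opnorm_ge0.
  by apply/opnorm_le => //; exact: opnorm_ge0.
have Ab : bounded_operator A by apply/boundedP; split => //; exists t.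
by split=> //; apply: le_lt_trans t1; apply/opnorm_le.
Qed.

End Two.
End RealStructure.

(** Vectors with the same real inner products are equal; this turns an additive
    identity between vectors into a ring identity in R. *)
Ltac vec := apply: ip_eq => ?; rewrite ?(ipDl, ipNl, ipZl, ip0l); try ring.

(** * Inverses and square roots by successive approximation *)

Section Complete.
Context {R : realType} {k : scalar_kind}.
Local Notation F := (scalar_field R k).

Lemma geometric_small (c r e : R) : 0 <= r -> r < 1 -> 0 < e ->
  exists n, c * r ^+ n < e.
Proof.
move=> r0 r1 e0.
have r1' : `|r| < 1 by rewrite ger0_norm.
have /cvgrPdist_lt /(_ e e0) [n _ /(_ n (leqnn n))] := cvg_geometric c r1'.
by rewrite /geometric /= sub0r normrN => /ltr_normlW; exists n.
Qed.

Lemma geometric_le0 (a c r : R) : 0 <= r -> r < 1 ->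
  (forall n, a <= c * r ^+ n) -> a <= 0.
Proof.
move=> r0 r1 ac; rewrite leNgt; apply/negP => a0.
have [n] := geometric_small c r0 r1 a0; by rewrite ltNge ac.
Qed.

Context {V : hilbertType R k}.

(** The explicit rate is what allows operators to be built as pointwise limits,
    with no topology on a space of operators. *)
Lemma geometric_cauchy (u : nat -> V) (c r : R) : 0 <= r -> r < 1 ->
  (forall n, nrm (u n.+1 - u n) <= c * r ^+ n) ->
  exists l, forall n, nrm (u n - l) <= c / (1 - r) * r ^+ n.
Proof.
move=> r0 r1 du.
have r1' : 0 < 1 - r by lra.
have c0 : 0 <= c by have := du 0%N; rewrite expr0 mulr1; apply: le_trans; exact: nrm_ge0.
have tail n m : nrm (u (n + m)%N - u n) <= c / (1 - r) * r ^+ n * (1 - r ^+ m).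
  elim: m => [|m IH]; first by rewrite addn0 subrr nrm0 expr0 subrr mulr0.
  have -> : u (n + m.+1)%N - u n = (u (n + m).+1 - u (n + m)%N) + (u (n + m)%N - u n).
    by rewrite addnS addrA subrK.
  apply: le_trans (nrmD _ _) _; apply: le_trans (lerD (du _) IH) _.
  rewrite le_eqVlt; apply/orP; left; apply/eqP; rewrite exprD exprS; field.
  by rewrite gt_eqF.
have tail2 n m : nrm (u (n + m)%N - u n) <= c / (1 - r) * r ^+ n.
  apply: le_trans (tail n m) _; rewrite ler_piMr ?lerBlDr ?lerDl ?exprn_ge0 //.
  by rewrite !mulr_ge0 ?exprn_ge0 ?invr_ge0 // ltW.
have /cauchy_cvg/cvg_ex [l ul] : cauchy (u @ \oo).
  apply: cauchy_exP => e e0.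
  have [n ne] : exists n, c / (1 - r) * r ^+ n < sre e.
    by apply: geometric_small => //; rewrite -(@ltr_remb R k) remb0 sreK // ltW.
  exists (u n); exists n => // m /= nm.
  rewrite -ball_normE /= -(subnKC nm) -rembnrm -opprB nrmN -(sreK (ltW e0)) ltr_remb.
  exact: le_lt_trans (tail2 _ _) ne.
exists l => n; apply/ler_addgt0Pr => e e0.
have e0' : 0 < remb e :> F by rewrite -remb0 ltr_remb.
have /cvgrPdist_lt /(_ _ e0') [m _ /(_ (n + m)%N (leq_addl _ _))] := ul.
rewrite /= -rembnrm ltr_remb => h.
have -> : u n - l = (u n - u (n + m)%N) + (u (n + m)%N - l) by rewrite addrA subrK.
apply: le_trans (nrmD _ _) _; apply: lerD; last by rewrite -opprB nrmN ltW.
by rewrite -opprB nrmN.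
Qed.

(** The Neumann series: P x = z is solved by iterating x |-> z + (x - P x), which
    contracts distances by the factor t. *)
Lemma inv_opP (P : V -> V) (t : R) : linear P -> 0 <= t -> t < 1 ->
  (forall x, nrm (x - P x) <= t * nrm x) ->
  [/\ bounded_operator (inv_op P), cancel P (inv_op P) & cancel (inv_op P) P].
Proof.
move=> Pl t0 t1 Pt.
suff [S hS] : exists S, [/\ bounded_operator S, cancel P S & cancel S P].
  exact: (@getPex _ [set S | [/\ bounded_operator S, cancel P S & cancel S P]]
            (ex_intro _ S hS)).
have t1' : 0 < 1 - t by lra.
have low x : nrm x <= (1 - t)^-1 * nrm (P x).
  rewrite mulrC ler_pdivlMr // mulrBr mulr1 lerBlDr mulrC.
  apply: le_trans (lerD (lexx _) (Pt x)); rewrite -{1}(subrK (P x) x) addrC.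
  exact: nrmD.
have inj x y : P x = P y -> x = y.
  move=> e; apply/eqP; rewrite -subr_eq0; apply/eqP/nrm_eq0/eqP.
  rewrite eq_le nrm_ge0 andbT; apply: le_trans (low _) _.
  by rewrite (linB Pl) e subrr nrm0 mulr0.
have surj z : exists x, P x = z.
  pose u := fix u n := if n is m.+1 then z + (u m - P (u m)) else 0.
  have uS n : u n.+1 - u n = z - P (u n) by rewrite /= addrA addrAC addrK.
  have du n : nrm (u n.+1 - u n) <= nrm z * t ^+ n.
    elim: n => [|n IH]; first by rewrite uS /= (lin0 Pl) subr0 expr0 mulr1.
    have -> : u n.+2 - u n.+1 = (u n.+1 - u n) - P (u n.+1 - u n).
      by rewrite uS (linB Pl) uS /=; vec.
    by apply: le_trans (Pt _) _; rewrite exprS mulrCA ler_wpM2l.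
  have [l ul] := geometric_cauchy t0 t1 du; exists l.
  apply/eqP; rewrite -subr_eq0; apply/eqP/nrm_eq0/eqP.
  rewrite eq_le nrm_ge0 andbT.
  apply: (@geometric_le0 _ (nrm z + (1 + t) * (nrm z / (1 - t))) t) => // n.
  have -> : P l - z = - (u n.+1 - u n) + ((u n - l) - P (u n - l)) - (u n - l).
    by rewrite uS (linB Pl); vec.
  apply: le_trans (nrmD _ _) _.
  apply: le_trans (lerD (nrmD _ _) (lexx _)) _; rewrite !nrmN.
  have h1 := du n; have h2 := Pt (u n - l); have h3 := ul n.
  have h4 : t * nrm (u n - l) <= t * (nrm z / (1 - t) * t ^+ n) by rewrite ler_wpM2l.
  lra.
have [S hS] := choice surj.
exists S; split=> [|x|x]; last exact: hS.
  apply/boundedP; split=> [a x y|]; first by apply: inj; rewrite Pl !hS.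
  exists (1 - t)^-1; split=> [|x]; first by rewrite invr_ge0 ltW.
  by rewrite -{2}(hS x).
by apply: inj; rewrite hS.
Qed.

Lemma positiveP (S : V -> V) : positive_operator S ->
  [/\ linear S, forall x y, ip (S x) y = ip x (S y) & forall x, 0 <= ip (S x) x].
Proof.
case=> [[Sl _] sa p]; split=> // [x y|x]; first by rewrite /ip sa.
by rewrite -(@sre0 R k); apply: sre_mono.
Qed.

Lemma ip_pos_inner (S : V -> V) : linear S ->
  (forall x y, ip (S x) y = ip x (S y)) -> (forall x, 0 <= ip (S x) x) ->
  forall x, 0 <= inner (S x) x.
Proof.
move=> Sl sa p x.
have e : sconj (inner (S x) x) = inner (S x) x.
  by rewrite -innerC (ip_inner Sl sa).
by rewrite (sconj_fixed e) -remb0 ler_remb; exact: p.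
Qed.

(** With T = 1 - P, a square root of P is 1 - Y where Y = (T + Y^2) / 2. On
    operators of norm at most t the map Y |-> (T + Y^2) / 2 is a contraction of
    ratio t, and its iterates from 0 are self-adjoint; no spectral
    theory enters, so both scalar fields are treated alike. *)
Lemma sqrt_exists (P : V -> V) (t : R) : linear P ->
  (forall x y, ip (P x) y = ip x (P y)) -> 0 <= t -> t < 1 ->
  (forall x, nrm (x - P x) <= t * nrm x) ->
  exists S, positive_operator S /\ S \o S = P.
Proof.
move=> Pl Psa t0 t1 Pt.
pose Y := fix Y n := if n is m.+1 then
  fun x => remb 2^-1 *: ((x - P x) + Y m (Y m x)) else fun=> 0 : V.
have Yl n : linear (Y n).
  elim: n => [|n IH] a x y /=; first by rewrite scaler0 addr0.
  rewrite Pl !IH [in RHS]scalerA [a * _]mulrC -scalerA -scalerDr; congr (_ *: _).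
  by rewrite !(scalerDr, scalerN); vec.
have Ysa n x y : ip (Y n x) y = ip x (Y n y).
  elim: n x y => [|n IH] x y /=; first by rewrite ip0l ip0r.
  by rewrite ipZl ipZr !(ipDl, ipDr, ipNl, ipNr) Psa !IH.
have Yt n x : nrm (Y n x) <= t * nrm x.
  elim: n x => [|n IH] x /=; first by rewrite nrm0 mulr_ge0 ?nrm_ge0.
  rewrite nrmZ sre_norm_remb ger0_norm //.
  have h := nrmD (x - P x) (Y n (Y n x)).
  have h1 := Pt x; have h2 := IH (Y n x); have h3 := IH x.
  have h4 : t * nrm (Y n x) <= 1 * nrm (Y n x) by rewrite ler_wpM2r ?nrm_ge0 // ltW.
  lra.
have YS n x : Y n.+1 x = remb 2^-1 *: ((x - P x) + Y n (Y n x)) by [].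
(* Y^2 - Z^2 = Y (Y - Z) + (Y - Z) Z holds for operators that do not commute *)
have dY n x : nrm (Y n.+1 x - Y n x) <= nrm x * t ^+ n.
  elim: n x => [|n IH] x.
    by rewrite /= subr0; have /= := Yt 1%N x; rewrite expr0; have := nrm_ge0 x; nra.
  have -> : Y n.+2 x - Y n.+1 x = remb 2^-1 *:
      (Y n.+1 (Y n.+1 x - Y n x) + (Y n.+1 (Y n x) - Y n (Y n x))).
    by rewrite (YS n.+1) (YS n) (linB (Yl n.+1)); vec.
  rewrite nrmZ sre_norm_remb ger0_norm //.
  have h := nrmD (Y n.+1 (Y n.+1 x - Y n x)) (Y n.+1 (Y n x) - Y n (Y n x)).
  have h1 := Yt n.+1 (Y n.+1 x - Y n x).
  have h2 : t * nrm (Y n.+1 x - Y n x) <= t * (nrm x * t ^+ n) by rewrite ler_wpM2l.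
  have h3 := IH (Y n x).
  have h4 : nrm (Y n x) * t ^+ n <= t * nrm x * t ^+ n by rewrite ler_wpM2r ?exprn_ge0.
  rewrite exprS; lra.
have [L hL] := choice (fun x => geometric_cauchy t0 t1 (dY ^~ x)).
have Lt x : nrm (L x) <= t * nrm x.
  rewrite -subr_le0; apply: (@geometric_le0 _ (nrm x / (1 - t)) t) => // n.
  rewrite lerBlDl.
  have -> : L x = Y n x - (Y n x - L x) by vec.
  by apply: le_trans (nrmD _ _) _; rewrite nrmN lerD.
have Ll : linear L.
  move=> a x y; apply/eqP; rewrite -subr_eq0; apply/eqP/nrm_eq0/eqP.
  rewrite eq_le nrm_ge0 andbT.
  apply: (@geometric_le0 _ ((nrm (a *: x + y) + sre `|a| * nrm x + nrm y) / (1 - t)) t) => // n.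
  have -> : L (a *: x + y) - (a *: L x + L y) =
      - (Y n (a *: x + y) - L (a *: x + y)) + (a *: (Y n x - L x) + (Y n y - L y)).
    by rewrite Yl scalerDr scalerN; vec.
  apply: le_trans (nrmD _ _) _; rewrite nrmN.
  apply: le_trans (lerD (hL _ n) (nrmD _ _)) _; rewrite nrmZ.
  have h1 := hL y n.
  have h2 : sre `|a| * nrm (Y n x - L x) <= sre `|a| * (nrm x / (1 - t) * t ^+ n).
    by rewrite ler_wpM2l ?sre_norm_ge0.
  by rewrite !mulrDl; lra.
have Lsa x y : ip (L x) y = ip x (L y).
  apply/eqP; rewrite -subr_eq0 -normr_eq0 eq_le normr_ge0 andbT.
  apply: (@geometric_le0 _ (2 * (nrm x * nrm y / (1 - t))) t) => // n.
  have -> : ip (L x) y - ip x (L y) = - ip (Y n x - L x) y + ip x (Y n y - L y).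
    by rewrite ipDl ipDr ipNl ipNr Ysa; ring.
  apply: le_trans (ler_normD _ _) _; rewrite normrN.
  apply: le_trans (lerD (ip_norm _ _) (ip_norm _ _)) _.
  have h1 : nrm (Y n x - L x) * nrm y <= nrm x / (1 - t) * t ^+ n * nrm y.
    by rewrite ler_wpM2r ?nrm_ge0.
  have h2 : nrm x * nrm (Y n y - L y) <= nrm x * (nrm y / (1 - t) * t ^+ n).
    by rewrite ler_wpM2l ?nrm_ge0.
  lra.
have LE x : L x = remb 2^-1 *: ((x - P x) + L (L x)).
  apply/eqP; rewrite -subr_eq0; apply/eqP/nrm_eq0/eqP.
  rewrite eq_le nrm_ge0 andbT.
  apply: (@geometric_le0 _ (3 * (nrm x / (1 - t))) t) => // n.
  have -> : L x - remb 2^-1 *: ((x - P x) + L (L x)) =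
     - (Y n.+1 x - L x) + remb 2^-1 *: (Y n (Y n x - L x) + (Y n (L x) - L (L x))).
    by rewrite YS (linB (Yl n)); vec.
  apply: le_trans (nrmD _ _) _; rewrite nrmN nrmZ sre_norm_remb ger0_norm //.
  have h1 := hL x n.+1; have h2 := Yt n (Y n x - L x); have h3 := hL x n.
  have h4 := hL (L x) n; have h5 := nrmD (Y n (Y n x - L x)) (Y n (L x) - L (L x)).
  set e := nrm x / (1 - t) * t ^+ n in h3 *.
  have e0 : 0 <= e by rewrite !mulr_ge0 ?nrm_ge0 ?exprn_ge0 ?invr_ge0 //; lra.
  have h6 : t * nrm (Y n x - L x) <= e by nra.
  have h7 : nrm x / (1 - t) * t ^+ n.+1 <= e by rewrite exprS mulrCA -/e; nra.
  have h8 : nrm (L x) / (1 - t) * t ^+ n <= e.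
    apply: ler_wpM2r; rewrite ?exprn_ge0 //; apply: ler_wpM2r; first by rewrite invr_ge0; lra.
    by have := Lt x; have := nrm_ge0 x; nra.
  by rewrite -mulrA -/e; lra.
exists (fun x => x - L x); split; last first.
  by apply/funext => x /=; rewrite (linB Ll) {1 2}LE; vec; field.
have Sl : linear (fun x => x - L x).
  by move=> a x y; rewrite Ll scalerDr scalerN; vec.
have Ssa x y : ip (x - L x) y = ip x (y - L y).
  by rewrite ipDl ipDr ipNl ipNr Lsa.
have Sp x : 0 <= ip (x - L x) x.
  rewrite ipDl ipNl ipxx; have := ip_le (L x) x; have := Lt x.
  by have := nrm_ge0 x; nra.
split; [|exact: (ip_inner Sl Ssa)|exact: (ip_pos_inner Sl Ssa Sp)].
apply/boundedP; split=> //; exists (1 + t); split=> [|x]; first lra.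
by apply: le_trans (nrmD _ _) _; rewrite nrmN mulrDl mul1r lerD2l.
Qed.

(** Any square root S of P commutes with P, so it is inverted by Q S, where Q is
    the inverse of P. *)
Lemma sqrt_opP (P : V -> V) (t : R) : linear P ->
  (forall x y, ip (P x) y = ip x (P y)) -> 0 <= t -> t < 1 ->
  (forall x, nrm (x - P x) <= t * nrm x) ->
  let S := sqrt_op P in
  [/\ positive_operator S, (forall x, S (S x) = P x), bounded_operator (inv_op S),
      cancel S (inv_op S) & cancel (inv_op S) S].
Proof.
move=> Pl Psa t0 t1 Pt S.
have [Sp SS] : positive_operator S /\ S \o S = P.
  have [S0 hS0] := sqrt_exists Pl Psa t0 t1 Pt.
  exact: (@getPex _ [set S | positive_operator S /\ S \o S = P] (ex_intro _ S0 hS0)).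
have SE x : S (S x) = P x by rewrite -SS.
have [Sl Ssa Sge] := positiveP Sp.
suff [T hT] : exists T, [/\ bounded_operator T, cancel S T & cancel T S].
  have [] := @getPex _ [set T | [/\ bounded_operator T, cancel S T & cancel T S]]
            (ex_intro _ T hT).
  by split.
have [Qb PQ QP] := inv_opP Pl t0 t1 Pt.
set Q := inv_op P in Qb PQ QP.
have SQ x : S (Q x) = Q (S x).
  have PS y : P (S y) = S (P y) by rewrite -!SE.
  by rewrite -[LHS]PQ PS QP.
exists (Q \o S); split=> [|x|x] /=; last 2 first.
- by rewrite SE PQ.
- by rewrite SQ SE PQ.
have /boundedP [_ [s [s0 Ss]]] : bounded_operator S by case: Sp.
move/boundedP: Qb => [Ql [q [q0 Qq]]]; apply/boundedP; split.
  by move=> a x y /=; rewrite Sl Ql.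
exists (q * s); split=> [|x /=]; first exact: mulr_ge0.
by apply: le_trans (Qq _) _; rewrite -mulrA ler_wpM2l.
Qed.
End Complete.

(** * Parseval frames and adjoints *)

Section Frames.
Context {R : realType} {k : scalar_kind}.
Local Notation F := (scalar_field R k).

(** An orthonormal basis enters only through its resolution of the identity,
    [frame e x = x]; orthogonality itself is left implicit. *)
Definition frame (V : hilbertType R k) (e : seq V) (x : V) : V :=
  \sum_(u <- e) inner x u *: u.

Lemma frame_linear (V : hilbertType R k) (e : seq V) : linear (frame e).
Proof.
move=> a x y; rewrite /frame scaler_sumr -big_split /=; apply: eq_bigr => u _.
by rewrite innerDl innerZl scalerDl scalerA.
Qed.

Lemma frame_sa (V : hilbertType R k) (e : seq V) x y :
  inner (frame e x) y = inner x (frame e y).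
Proof.
rewrite /frame (big_morph (inner ^~ y) (fun a b => innerDl a b y) (inner0l y)).
rewrite (big_morph (inner x) (fun a b => innerDr a b x) (inner0r x)).
by apply: eq_bigr => u _; rewrite innerZl innerZr mulrC [inner u y]innerC.
Qed.

(** Gram-Schmidt: the normalized component of x orthogonal to the previous frame
    is added. Vectors already resolved are orthogonal to it, and stay resolved. *)
Lemma frame_exists (V : hilbertType R k) (s : seq V) :
  exists e, forall u, u \in s ++ e -> frame e u = u.
Proof.
elim: s => [|x s [e IH]]; first by exists [::].
pose x' := x - frame e x.
have fe y : frame e (frame e y) = frame e y.
  rewrite {2 3}/frame (big_morph (frame e) (linD (frame_linear e)) (lin0 (frame_linear e))).
  rewrite !big_seq; apply: eq_bigr => u ue.
  by rewrite (linZ (frame_linear e)) IH // mem_cat ue orbT.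
have ort y : frame e y = y -> inner y x' = 0.
  by move=> ey; rewrite innerDr -scaleN1r innerZr -frame_sa ey rmorphN1 mulN1r subrr.
case: (eqVneq (nrm x') 0) => [/nrm_eq0 x'0|x'0].
  exists e => u; rewrite inE => /orP[/eqP ->|]; last exact: IH.
  by apply/eqP; rewrite eq_sym -subr_eq0 -/x' x'0.
pose v := remb (nrm x')^-1 *: x'.
have fold y : frame e y = y -> frame (v :: e) y = y.
  by move=> ey; rewrite /frame big_cons -/(frame e y) ey innerZr (ort y ey) mulr0 scale0r add0r.
have fx' : frame (v :: e) x' = x'.
  have -> : frame (v :: e) x' = inner x' v *: v + frame e x' by rewrite /frame big_cons.
  rewrite (linB (frame_linear e)) fe subrr addr0 /v innerZr inner_norm -rembnrm scalerA.
  rewrite -[X in _ = X]scale1r; congr (_ *: _).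
  by rewrite sconj_remb expr2 -!rembM -(@remb1 R k); congr remb; field.
exists (v :: e) => u.
have fl := frame_linear (v :: e).
rewrite cat_cons inE mem_cat inE => /or4P[/eqP ->|us|/eqP ->|ue].
- by rewrite -[x in LHS](subrK (frame e x)) -/x' (linD fl) fx' fold // subrK.
- by apply/fold/IH; rewrite mem_cat us.
- by rewrite (linZ fl) fx'.
- by apply/fold/IH; rewrite mem_cat ue orbT.
Qed.

Context (K : finHilbertType R k).

Lemma parseval_frame : exists e : seq K, forall x, frame e x = x.
Proof.
have [e he] := frame_exists (vbasis (fullv : {vspace K})).
exists e => x; have fl := frame_linear e.
rewrite {1 2}(coord_vbasis (memvf x)).
rewrite (big_morph (frame e) (linD fl) (lin0 fl)); apply: eq_bigr => i _.
by rewrite (linZ fl) he // mem_cat mem_nth // size_tuple.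
Qed.

(** A real-linear functional is controlled by its values on the vectors u and
    [iunit *: u] of a Parseval frame, rescaled so that the real coordinates of x are
    at most its norm. The list is independent of the functional: this is how finiteness of the
    dimension turns pointwise convergence into uniform convergence. *)
Lemma functional_bound : exists s : seq K, forall f : K -> R,
  (forall x y, f (x + y) = f x + f y) -> (forall r x, f (remb r *: x) = r * f x) ->
  forall x, `|f x| <= (\sum_(u <- s) `|f u|) * nrm x.
Proof.
have [e he] := parseval_frame.
exists ([seq remb (nrm u) *: u | u <- e] ++ [seq remb (nrm u) *: (iunit *: u) | u <- e]).
move=> f fD fZ x.
have f0 : f 0 = 0 by have := fZ 0 0; rewrite mul0r scaler0.
rewrite -{1}(he x) /frame (big_morph f fD f0) big_cat !big_map /= -big_split /=.
apply: le_trans (ler_norm_sum _ _ _) _; rewrite mulr_suml; apply: ler_sum => u _.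
have [s [zE sb]] := scalarE (inner x u).
have zb : sre `|inner x u| <= nrm x * nrm u.
  exact: inner_norm_le.
rewrite {1}zE scalerDl fD -scalerA !fZ -/(ip x u).
apply: le_trans (ler_normD _ _) _; rewrite !normrM !(ger0_norm (nrm_ge0 _)).
have h1 : `|sre (inner x u)| * `|f u| <= nrm x * nrm u * `|f u|.
  by rewrite ler_wpM2r //; exact: le_trans (sre_le_norm _) zb.
have h2 : `|s| * `|f (iunit *: u)| <= nrm x * nrm u * `|f (iunit *: u)|.
  by rewrite ler_wpM2r //; exact: le_trans sb zb.
rewrite /ip; lra.
Qed.

Lemma bilinear_bound : exists s : seq K, forall B : K -> K -> R,
  (forall x y z, B (x + y) z = B x z + B y z) ->
  (forall r x z, B (remb r *: x) z = r * B x z) ->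
  (forall x y z, B z (x + y) = B z x + B z y) ->
  (forall r x z, B z (remb r *: x) = r * B z x) ->
  forall x y, `|B x y| <= (\sum_(u <- s) \sum_(v <- s) `|B u v|) * (nrm x * nrm y).
Proof.
have [s hs] := functional_bound; exists s => B BDl BZl BDr BZr x y.
apply: le_trans (hs (B ^~ y) _ _ x) _ => //.
rewrite [nrm x * _]mulrC mulrA ler_wpM2r ?nrm_ge0 // mulr_suml.
by apply: ler_sum => u _; exact: hs.
Qed.

Context {H : hilbertType R k}.
Lemma adjointP (A : K -> H) : linear A ->
  forall x y, inner (A x) y = inner x (adjoint A y).
Proof.
move=> Al.
suff [B hB] : exists B : H -> K, forall x y, inner (A x) y = inner x (B y).
  exact: (@getPex _ [set B | forall x y, inner (A x) y = inner x (B y)] (ex_intro _ B hB)).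
have [e he] := parseval_frame.
exists (fun y => \sum_(u <- e) inner y (A u) *: u) => x y.
rewrite -{1}(he x) /frame (big_morph A (linD Al) (lin0 Al)).
rewrite (big_morph (inner ^~ y) (fun a b => innerDl a b y) (inner0l y)).
rewrite (big_morph (inner x) (fun a b => innerDr a b x) (inner0r x)).
apply: eq_bigr => u _; rewrite (linZ Al) innerZl innerZr mulrC; congr (_ * _).
by rewrite -innerC.
Qed.

Lemma ip_adj (A : K -> H) : linear A -> forall x y, ip (A x) y = ip x (adjoint A y).
Proof. by move=> Al x y; rewrite /ip adjointP. Qed.

Lemma ip_adj_bound (A : K -> H) (B : H -> K) (t : R) : linear A -> 0 <= t ->
  (forall x, nrm (A x) <= t * nrm x) -> (forall x y, ip (A x) y = ip x (B y)) ->
  forall y, nrm (B y) <= t * nrm y.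
Proof.
move=> Al t0 At AB y.
have := ip_le (A (B y)) y; rewrite AB ipxx => h.
have h1 : nrm (A (B y)) * nrm y <= t * nrm (B y) * nrm y by rewrite ler_wpM2r ?nrm_ge0.
case: (eqVneq (nrm (B y)) 0) => [->|b0]; first by rewrite mulr_ge0 ?nrm_ge0.
rewrite -(@ler_pM2l _ (nrm (B y))) ?lt0r ?b0 ?nrm_ge0 //.
by rewrite -expr2; apply: le_trans h _; apply: le_trans h1 _; rewrite mulrCA mulrA.
Qed.

Lemma adjoint_linear (A : K -> H) : linear A -> linear (adjoint A).
Proof.
move=> Al a x y; apply: ip_eq => z; rewrite ipC -ip_adj //.
by rewrite [RHS]ipC ipDr [RHS]ipDr /ip !innerZr -!adjointP.
Qed.
End Frames.

(** * Hyperbolic functions *)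

Section Cosh.
Context {R : realType}.
Implicit Types a b t : R.
Definition cosh t : R := (expR t + expR (- t)) / 2.
Definition sinh t : R := (expR t - expR (- t)) / 2.

Lemma cosh_sinh t : cosh t ^+ 2 = 1 + sinh t ^+ 2.
Proof. by rewrite /cosh /sinh expRN; field; rewrite gt_eqF ?expR_gt0. Qed.

Lemma coshD a b : cosh (a + b) = cosh a * cosh b + sinh a * sinh b.
Proof. by rewrite /cosh /sinh opprD !expRD; field. Qed.

Lemma cosh_gt0 t : 0 < cosh t.
Proof. by rewrite divr_gt0 ?addr_gt0 ?expR_gt0. Qed.

Lemma cosh_ge1 t : 1 <= cosh t.
Proof.
have := cosh_sinh t; have := cosh_gt0 t; have := sqr_ge0 (sinh t); nra.
Qed.

Lemma sinh_ge0 t : 0 <= t -> 0 <= sinh t.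
Proof. by move=> t0; rewrite divr_ge0 // subr_ge0 ler_expR; lra. Qed.

Lemma sinh_gt0 t : 0 < t -> 0 < sinh t.
Proof. by move=> t0; rewrite divr_gt0 // subr_gt0 ltr_expR; lra. Qed.

Lemma cosh_gt1 t : 0 < t -> 1 < cosh t.
Proof.
move=> /sinh_gt0 t0; have := cosh_sinh t; have := cosh_gt0 t; nra.
Qed.

Lemma cosh_half t : 1 + cosh t = 2 * cosh (t / 2) ^+ 2.
Proof.
have {1}-> : t = t / 2 + t / 2 by lra.
by rewrite coshD -!expr2 {1}cosh_sinh; have := cosh_sinh (t / 2); lra.
Qed.

Lemma cosh_onto a : 1 <= a -> exists t, 0 <= t /\ cosh t = a.
Proof.
move=> a1; pose s := Num.sqrt (a ^+ 2 - 1).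
have s2 : s ^+ 2 = a ^+ 2 - 1 by rewrite sqr_sqrtr //; nra.
have s0 : 0 <= s by exact: sqrtr_ge0.
exists (ln (a + s)); split; first by rewrite ln_ge0 //; lra.
have p : 0 < a + s by lra.
rewrite /cosh expRN lnK ?posrE //.
have -> : (a + s)^-1 = a - s.
  by apply: (mulfI (lt0r_neq0 p)); rewrite mulfV ?lt0r_neq0 //; nra.
by field.
Qed.

Lemma cosh_le a b : 0 <= a -> a <= b -> cosh a <= cosh b.
Proof.
move=> a0 ab; have ba : 0 <= b - a by lra.
have -> : b = a + (b - a) by ring.
rewrite coshD; have := sinh_ge0 a0; have := sinh_ge0 ba.
have := cosh_ge1 (b - a); have := cosh_gt0 a.
move: (cosh a) (cosh (b - a)) (sinh a) (sinh (b - a)) => x y z t x0 y1 t0 z0.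
have h : 0 <= x * (y - 1) by apply: mulr_ge0; [exact: ltW|lra].
have := mulr_ge0 z0 t0; lra.
Qed.

Lemma tanh_cosh t : tanh t = sinh t / cosh t.
Proof.
rewrite /tanh /sinh /cosh; field; rewrite gt_eqF ?addr_gt0 ?expR_gt0 //.
Qed.

Lemma tanh_sqr t : (1 - tanh t ^+ 2) * cosh t ^+ 2 = 1.
Proof.
rewrite tanh_cosh exprMn exprVn mulrBl mul1r divfK ?sqrf_eq0 ?gt_eqF ?cosh_gt0 //.
by rewrite cosh_sinh; ring.
Qed.

Lemma tanh_ge0 t : 0 <= t -> 0 <= tanh t.
Proof. by move=> t0; rewrite tanh_cosh divr_ge0 ?sinh_ge0 // ltW // cosh_gt0. Qed.

Lemma tanh_lt1 t : tanh t < 1.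
Proof.
rewrite tanh_cosh ltr_pdivrMr ?cosh_gt0 // mul1r /sinh /cosh.
by have := expR_gt0 (- t); lra.
Qed.

Lemma atanh_le a t : 0 <= a -> a < 1 -> 0 <= t -> (atanh a <= t) = (a <= tanh t).
Proof.
move=> a0 a1 t0.
have mono (x y : R) : 0 <= x -> x <= y -> y < 1 -> atanh x <= atanh y.
  move=> x0 xy y1; rewrite ler_pM2r //.
  have x1 : 0 < 1 - x by lra.
  have y1' : 0 < 1 - y by lra.
  rewrite ler_ln ?posrE ?divr_gt0 //; try lra.
  by rewrite ler_pdivrMr // mulrAC ler_pdivlMr //; lra.
have tK := tanhK t; have T0 := tanh_ge0 t0; have T1 := tanh_lt1 t.
have aK : tanh (atanh a) = a.
  by apply: atanhK; rewrite ger0_norm.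
move: (tanh t) tK T0 T1 => T tK T0 T1.
have [h|h] := leP a T; first by rewrite -tK; apply: mono.
apply: negbTE; rewrite -ltNge lt_neqAle -{2}tK (mono _ _ T0 (ltW h) a1) andbT.
apply/eqP => e; move: aK; rewrite -e -tK => aK.
have TT : tanh (atanh T) = T by apply: atanhK; rewrite ger0_norm.
by move: h; rewrite -aK TT ltxx.
Qed.

Lemma atanh_ge0 a : 0 <= a -> a < 1 -> 0 <= atanh a.
Proof.
move=> a0 a1; rewrite divr_ge0 // ln_ge0 // ler_pdivlMr; lra.
Qed.
End Cosh.

(** * The indefinite form on K x H *)

Section Forms.
Context {R : realType} {k : scalar_kind} {K : finHilbertType R k} {H : hilbertType R k}.
Local Notation F := (scalar_field R k).
Implicit Types A B C W X Y Z : K -> H.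

(** For this form of signature (K, H) the graph of an operator of the ball is a
    maximal positive subspace, and Moebius transformations are induced by its
    isometries. The geometry of rho is that of these positive subspaces. *)
Definition krein (y : K) (h : H) (y' : K) (h' : H) : R := ip y y' - ip h h'.
Definition pairing A B x y : R := krein x (A x) y (B y).
Definition graph_norm A x : R := Num.sqrt (pairing A A x x).

Lemma ball_linear A : operator_ball A -> linear A.
Proof. by case/ballP. Qed.

Lemma ball_coercive A : operator_ball A ->
  exists c, 0 < c /\ forall x, c * nrm x ^+ 2 <= pairing A A x x.
Proof.
case/ballP => _ [t [t0 t1 At]]; exists (1 - t ^+ 2); split=> [|x]; first nra.
rewrite /pairing /krein !ipxx mulrBl mul1r lerD2l lerN2 -exprMn ler_sqr ?nnegrE ?nrm_ge0 //.
by rewrite mulr_ge0 ?nrm_ge0.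
Qed.

Lemma coercive_ball A c : linear A -> 0 < c ->
  (forall x, c * nrm x ^+ 2 <= pairing A A x x) -> operator_ball A.
Proof.
move=> Al c0 Ac; apply/ballP; split=> //.
exists (Num.sqrt (1 - c)); split; first exact: sqrtr_ge0.
  have [c1|c1] := leP (1 - c) 0; first by rewrite ler0_sqrtr ?ltr01.
  by rewrite -[ltRHS]sqrtr1 ltr_sqrt //; lra.
move=> x; have := Ac x; rewrite /pairing /krein !ipxx => h.
have {}h : nrm (A x) ^+ 2 <= (1 - c) * nrm x ^+ 2 by lra.
have [c1|c1] := leP (1 - c) 0.
  rewrite ler0_sqrtr // mul0r.
  have := sqr_ge0 (nrm x); have := nrm_ge0 (A x); nra.
rewrite -ler_sqr ?nnegrE ?nrm_ge0 ?mulr_ge0 ?sqrtr_ge0 ?nrm_ge0 //.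
by rewrite exprMn sqr_sqrtr // ltW.
Qed.

Lemma pairing_ge0 A x : operator_ball A -> 0 <= pairing A A x x.
Proof.
by move=> /ball_coercive [c [c0 Ac]]; apply: le_trans (Ac x); rewrite mulr_ge0 ?sqr_ge0 // ltW.
Qed.

Lemma graph_norm_ge0 A x : 0 <= graph_norm A x.
Proof. exact: sqrtr_ge0. Qed.

Lemma graph_norm_sqr A x : operator_ball A -> graph_norm A x ^+ 2 = pairing A A x x.
Proof. by move=> Ab; rewrite sqr_sqrtr // pairing_ge0. Qed.

Lemma pairing_CS A x y : operator_ball A -> pairing A A x y <= graph_norm A x * graph_norm A y.
Proof.
move=> Ab; apply: le_trans (ler_norm _) _.
apply: quadratic_CS; rewrite ?pairing_ge0 // => r.
have := pairing_ge0 (remb r *: x + y) Ab; have Al := ball_linear Ab.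
rewrite /pairing /krein (linD Al) (linZ Al) !(ipDl, ipDr, ipZl, ipZr) (ipC y x) (ipC (A y) (A x)).
by congr (_ <= _); ring.
Qed.

Lemma ball_adj C : operator_ball C -> exists Cs : H -> K,
  [/\ linear Cs, forall x y, ip (C x) y = ip x (Cs y) &
   exists t, [/\ 0 <= t, t < 1, forall x, nrm (C x) <= t * nrm x & forall y, nrm (Cs y) <= t * nrm y]].
Proof.
case/ballP => Cl [t [t0 t1 Ct]]; exists (adjoint C); split.
- exact: adjoint_linear.
- exact: ip_adj.
by exists t; split=> //; apply: (ip_adj_bound Cl t0 Ct); exact: ip_adj.
Qed.

(** K x H is the sum of the graph of C, where the form is positive, and of its
    orthogonal complement, the set of all (Cs r, r), where the form is negative.
    The component p solves (1 - Cs C) p = y - Cs h. *)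
Lemma graph_split C Cs : operator_ball C -> (forall x y, ip (C x) y = ip x (Cs y)) -> linear Cs ->
  forall y h, exists p r, y = p + Cs r /\ h = C p + r.
Proof.
move=> Cb adj Csl y h; have Cl := ball_linear Cb.
have [t [t0 t1 Ct]] : exists t, [/\ 0 <= t, t < 1 & forall x, nrm (C x) <= t * nrm x].
  by case/ballP: Cb.
have Cst := ip_adj_bound Cl t0 Ct adj.
have [_ _ inv] : [/\ bounded_operator (inv_op (fun x => x - Cs (C x))),
   cancel (fun x => x - Cs (C x)) (inv_op (fun x => x - Cs (C x))) &
   cancel (inv_op (fun x => x - Cs (C x))) (fun x => x - Cs (C x))].
  apply: (@inv_opP _ _ _ _ t) => // [a x z|x].
    by rewrite Cl Csl scalerBr; vec.
  rewrite opprB addrC subrK; apply: le_trans (Cst _) _; rewrite ler_wpM2l //.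
  by apply: le_trans (Ct _) _; rewrite ler_piMl ?nrm_ge0 // ltW.
pose p := inv_op (fun x => x - Cs (C x)) (y - Cs h); exists p, (h - C p).
have e : p - Cs (C p) = y - Cs h := inv _.
split; last by vec.
have -> : y = (y - Cs h) + Cs h by vec.
by rewrite -e (linB Csl); vec.
Qed.

(** Cauchy-Schwarz on the orthogonal complement of the graph of C, where the
    opposite of the form is positive. *)
Lemma dual_CS C Cs r r' : operator_ball C -> (forall x y, ip (C x) y = ip x (Cs y)) ->
  linear Cs ->
  `|ip r r' - ip (Cs r) (Cs r')| <= Num.sqrt (ip r r - ip (Cs r) (Cs r)) * Num.sqrt (ip r' r' - ip (Cs r') (Cs r')).
Proof.
case/ballP => Cl [t [t0 t1 Ct]] adj Csl.
have Cst := ip_adj_bound Cl t0 Ct adj.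
have pos x : 0 <= ip x x - ip (Cs x) (Cs x).
  rewrite subr_ge0 !ipxx ler_sqr ?nnegrE ?nrm_ge0 //; apply: le_trans (Cst x) _.
  by rewrite ler_piMl ?nrm_ge0 // ltW.
apply: quadratic_CS => // s.
have := pos (remb s *: r + r').
rewrite (linD Csl) (linZ Csl) !(ipDl, ipDr, ipZl, ipZr) (ipC r' r) (ipC (Cs r') (Cs r)).
by congr (_ <= _); ring.
Qed.

(** The source of the triangle inequality of rho. The hypotheses bound by a and b
    the lengths of the components of the two vectors along the graph of C, and the
    Pythagorean rule then bounds those of the negative components by the square
    roots. With a = cosh s and b = cosh t for unit vectors the bound is
    cosh (s + t). *)
Lemma graph_triangle C y h y' h' (a b : R) : operator_ball C -> 0 <= a -> 0 <= b ->
  (forall x, krein x (C x) y h <= a * graph_norm C x) ->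
  (forall x, krein x (C x) y' h' <= b * graph_norm C x) ->
  krein y h y' h' <= a * b + Num.sqrt (a ^+ 2 - krein y h y h) * Num.sqrt (b ^+ 2 - krein y' h' y' h').
Proof.
move=> Cb a0 b0; have Cl := ball_linear Cb.
have [Cs [Csl adj _]] := ball_adj Cb.
have [p [r [-> ->]]] := graph_split Cb adj Csl y h.
have [p' [r' [-> ->]]] := graph_split Cb adj Csl y' h'.
have split x q s : krein x (C x) (q + Cs s) (C q + s) = pairing C C x q.
  by rewrite /pairing /krein !ipDr (adj _ s); ring.
have split2 q s q' s' : krein (q + Cs s) (C q + s) (q' + Cs s') (C q' + s') =
    pairing C C q q' - (ip s s' - ip (Cs s) (Cs s')).
  rewrite /pairing /krein !(ipDl, ipDr) (ipC s (C q')) (adj _ s) (adj _ s') (ipC (Cs s) q'); ring.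
have bound q s (c : R) : 0 <= c -> (forall x, krein x (C x) (q + Cs s) (C q + s) <= c * graph_norm C x) ->
    graph_norm C q <= c.
  move=> c0 /(_ q); rewrite split -graph_norm_sqr // expr2.
  have [<-//|q0] := eqVneq 0 (graph_norm C q).
  by rewrite ler_pM2r // lt0r eq_sym q0 graph_norm_ge0.
move=> /(bound _ _ _ a0) pa /(bound _ _ _ b0) pb; rewrite !split2.
have h1 : pairing C C p p' <= a * b.
  by apply: le_trans (pairing_CS _ _ Cb) _; apply: ler_pM; rewrite ?graph_norm_ge0.
have h2 := dual_CS r r' Cb adj Csl.
rewrite ler_norml in h2; case/andP: h2 => h2 _.
have sq q (c : R) : 0 <= c -> graph_norm C q <= c -> pairing C C q q <= c ^+ 2.
  by move=> c0 qc; rewrite -graph_norm_sqr // ler_sqr ?nnegrE ?graph_norm_ge0.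
have h3 : Num.sqrt (ip r r - ip (Cs r) (Cs r)) <=
    Num.sqrt (a ^+ 2 - (pairing C C p p - (ip r r - ip (Cs r) (Cs r)))).
  by apply: ler_wsqrtr; have := sq _ _ a0 pa; lra.
have h4 : Num.sqrt (ip r' r' - ip (Cs r') (Cs r')) <=
    Num.sqrt (b ^+ 2 - (pairing C C p' p' - (ip r' r' - ip (Cs r') (Cs r')))).
  by apply: ler_wsqrtr; have := sq _ _ b0 pb; lra.
have h5 := ler_pM (sqrtr_ge0 _) (sqrtr_ge0 _) h3 h4.
lra.
Qed.
End Forms.

(** * The distance rho through graphs *)

Section Bounded.
Context {R : realType} {k : scalar_kind} {U V W : hilbertType R k}.
Lemma bounded_comp (A : V -> W) (B : U -> V) :
  bounded_operator A -> bounded_operator B -> bounded_operator (A \o B).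
Proof.
move=> /boundedP [Al [c [c0 cA]]] /boundedP [Bl [d [d0 dB]]]; apply/boundedP; split.
  by move=> a x y /=; rewrite Bl Al.
exists (c * d); split=> [|x /=]; first exact: mulr_ge0.
by apply: le_trans (cA _) _; rewrite -mulrA ler_wpM2l.
Qed.

Lemma bounded_add (A B : U -> V) :
  bounded_operator A -> bounded_operator B -> bounded_operator (A \+ B).
Proof.
move=> /boundedP [Al [c [c0 cA]]] /boundedP [Bl [d [d0 dB]]]; apply/boundedP; split.
  by move=> a x y /=; rewrite Al Bl scalerDr; vec.
exists (c + d); split=> [|x /=]; first exact: addr_ge0.
by apply: le_trans (nrmD _ _) _; rewrite mulrDl lerD.
Qed.
End Bounded.

Section Mobius.
Context {R : realType} {k : scalar_kind} {K : finHilbertType R k} {H : hilbertType R k}.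
Local Notation F := (scalar_field R k).
Implicit Types A B C W X Y Z : K -> H.

Lemma ballN A : operator_ball A -> operator_ball (\- A).
Proof.
case/ballP => Al [t [t0 t1 At]]; apply/ballP; split.
  by move=> a x y /=; rewrite Al opprD scalerN.
by exists t; split=> // x /=; rewrite nrmN.
Qed.

(** Pythagoras for the splitting along the graph of - N: the vector
    (p - ad r, r - N p) has components (p, - N p) and (- ad r, r). *)
Lemma split_identity (N : K -> H) (ad : H -> K) p r :
  (forall x y, ip (N x) y = ip x (ad y)) ->
  ip r (r - N (ad r)) =
  ip p (p - ad (N p)) - krein (p - ad r) (r - N p) (p - ad r) (r - N p).
Proof.
move=> adj; rewrite /krein !(ipDl, ipDr, ipNl, ipNr) -!adj.
by rewrite (ipC r (N (ad r))) (ipC r (N p)) (ipC (ad r) p) !adj; ring.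
Qed.

(** Here a is the square root of 1 - A'A and m is 1 - A'B, with A' the adjoint
    of A. Put y = m' (a x) and
    split (y, B y) along the graph of A as (p, A p) plus a negative vector with
    second component r. Then x = a p, and the Moebius transform sends x to
    (1 - AA')^(1/2) r: the squared norms of x and of its image are the squared
    lengths of the two components, and their difference is that of (y, B y). *)
Lemma mobius_factor A B : operator_ball A -> operator_ball B ->
  exists a a' m m' : K -> K,
  [/\ [/\ linear a, linear a', cancel a a' & cancel a' a],
     (forall x y, ip (a x) y = ip x (a y)) /\ (forall x, ip (a x) (a x) = pairing A A x x),
     [/\ linear m', cancel m m', cancel m' m & forall x y, ip x (m y) = pairing A B x y],
     bounded_operator (mobius (\- A) B) &
     forall x, nrm (mobius (\- A) B x) ^+ 2 = nrm x ^+ 2 - pairing B B (m' (a x)) (m' (a x))].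
Proof.
move=> Ab Bb; have Al := ball_linear Ab; have Bl := ball_linear Bb.
pose N := (\- A) : K -> H; pose ad := adjoint N.
have Nb : operator_ball N := ballN Ab; have Nl : linear N := ball_linear Nb.
have NE x : N x = - A x by [].
have adl : linear ad := adjoint_linear Nl.
have adj x y : ip (A x) y = ip x (- ad y).
  by rewrite ipNr /ad -ip_adj // NE ipNl opprK.
have adNj x y : ip (N x) y = ip x (ad y) by exact: ip_adj.
have [t [t0 t1 Nt]] : exists t, [/\ 0 <= t, t < 1 & forall x, nrm (N x) <= t * nrm x].
  by case/ballP: Nb.
have [s [s0 s1 Bs]] : exists t, [/\ 0 <= t, t < 1 & forall x, nrm (B x) <= t * nrm x].
  by case/ballP: Bb.
have adt y : nrm (ad y) <= t * nrm y := ip_adj_bound Nl t0 Nt adNj y.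
pose PK := (idfun \- (ad \o N)) : K -> K.
pose PH := (idfun \- (N \o ad)) : H -> H.
have tt z : 0 <= z -> t * z <= z by move=> z0; rewrite ler_piMl // ltW.
have [] := @sqrt_opP _ _ _ PK t _ _ t0 t1 _.
- by move=> a x y; rewrite /PK /= Nl adl scalerBr; vec.
- move=> x y; rewrite /PK /= ipDl ipDr ipNl ipNr.
  by rewrite -adNj (ipC (ad _) y) -adNj (ipC (N y)).
- move=> x; rewrite /PK /= opprB addrC subrK; apply: le_trans (adt _) _.
  by rewrite ler_wpM2l //; apply: le_trans (Nt _) _; exact/tt/nrm_ge0.
set sK := sqrt_op PK => sKp sKE sKib sKK sKK'.
have [sKl sKsa _] := positiveP sKp; have [sKil _] := sKib; have [sKb _ _] := sKp.
have [] := @sqrt_opP _ _ _ PH t _ _ t0 t1 _.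
- by move=> a x y; rewrite /PH /= adl Nl scalerBr; vec.
- by move=> x y; rewrite /PH /= ipDl ipDr ipNl ipNr adNj (ipC x (N _)) adNj (ipC (ad x)).
- move=> x; rewrite /PH /= opprB addrC subrK; apply: le_trans (Nt _) _.
  by rewrite ler_wpM2l //; apply: le_trans (adt _) _; exact/tt/nrm_ge0.
set sH := sqrt_op PH => sHp sHE sHib sHK sHK'.
have [sHl sHsa _] := positiveP sHp.
pose m := (idfun \+ (ad \o B)) : K -> K.
have [] := @inv_opP _ _ _ m t _ t0 t1 _.
- by move=> a x y; rewrite /m /= Bl adl scalerDr; vec.
- move=> x; rewrite /m /= opprD addNKr nrmN; apply: le_trans (adt _) _.
  by rewrite ler_wpM2l //; apply: le_trans (Bs _) _; rewrite ler_piMl ?nrm_ge0 // ltW.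
move=> m'b mK mK'; have [m'l _] := m'b.
exists sK, (inv_op sK), m, (inv_op m); split=> //.
- split=> // x; rewrite -sKsa sKE /PK /= /pairing /krein ipDl ipNl (ipC (ad _)) -adNj /N /=.
  by rewrite ipNl ipNr opprK.
- split=> // x y; rewrite /m /= ipDr -adNj /pairing /krein /N /= ipNl; ring.
- have [Nbd _] := Nb; have [Bbd _] := Bb.
  apply: bounded_comp sKb; apply: bounded_comp m'b; apply: bounded_comp sHib _.
  exact: bounded_add.
move=> x; rewrite /mobius /= -/N -/ad -/PK -/PH -/sK -/sH -/m.
set y := inv_op m (sK x); pose p := inv_op sK x; pose r := B y + N p.
have xE : sK p = x by exact: sKK'.
have my : y + ad (B y) = p - ad (N p).
  have -> : y + ad (B y) = sK x by exact: mK'.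
  by rewrite -xE sKE.
have yE : y = p - ad r.
  have -> : y = (y + ad (B y)) - ad (B y) by vec.
  by rewrite my /r (linD adl); vec.
have e : N y + B y = sH (sH r).
  by rewrite sHE /PH /= yE (linB Nl) -yE /r; vec.
have ByE : B y = r - N p by rewrite /r; vec.
rewrite [X in inv_op sH X]e sHK -!ipxx -xE sHsa sHE sKsa sKE /PH /PK /= /pairing ByE yE.
exact: split_identity.
Qed.
End Mobius.

Section Rho.
Context {R : realType} {k : scalar_kind} {K : finHilbertType R k} {H : hilbertType R k}.
Local Notation F := (scalar_field R k).
Implicit Types A B C W X Y Z : K -> H.

Lemma graph_norm_coercive A : operator_ball A ->
  exists c : R, 0 < c /\ forall x, c * nrm x <= graph_norm A x.
Proof.
move=> Ab; have [c [c0 Ac]] := ball_coercive Ab.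
exists (Num.sqrt c); split=> [|x]; first by rewrite sqrtr_gt0.
rewrite -ler_sqr ?nnegrE ?graph_norm_ge0 ?mulr_ge0 ?sqrtr_ge0 ?nrm_ge0 //.
by rewrite exprMn graph_norm_sqr // (sqr_sqrtr (ltW c0)).
Qed.

Lemma pairing_bound A B : operator_ball A -> operator_ball B ->
  exists c : R, forall x y, pairing A B x y <= c * (graph_norm A x * graph_norm B y).
Proof.
move=> Ab Bb; have [c [c0 Ac]] := graph_norm_coercive Ab; have [d [d0 Bd]] := graph_norm_coercive Bb.
have [_ [s [s0 s1 As]]] := (ballP A).1 Ab; have [_ [t [t0 t1 Bt]]] := (ballP B).1 Bb.
exists (2 / (c * d)) => x y.
have h1 : pairing A B x y <= 2 * (nrm x * nrm y).
  have h := ip_le x y; have := ip_norm (A x) (B y); rewrite ler_norml => /andP[h' _].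
  have h3 : nrm (A x) * nrm (B y) <= nrm x * nrm y.
    apply: ler_pM; rewrite ?nrm_ge0 //.
      by apply: le_trans (As x) _; rewrite ler_piMl ?nrm_ge0 // ltW.
    by apply: le_trans (Bt y) _; rewrite ler_piMl ?nrm_ge0 // ltW.
  by rewrite /pairing /krein; lra.
apply: le_trans h1 _; rewrite mulrAC ler_pdivlMr ?mulr_gt0 //.
rewrite -mulrA ler_pM2l // mulrC mulrACA; apply: ler_pM; rewrite ?mulr_ge0 ?nrm_ge0 // ltW //.
Qed.

(** By [mobius_factor] the norm of the Moebius transform measures how much longer
    the component of (y, B y) along the graph of A is than (y, B y) itself, and the
    length of that component is the supremum of its pairings with unit vectors of
    the graph. *)
Lemma opnorm_mobius A B t : operator_ball A -> operator_ball B -> 0 <= t ->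
  opnorm (mobius (\- A) B) <= tanh t <->
  forall x y, pairing A B x y <= cosh t * (graph_norm A x * graph_norm B y).
Proof.
move=> Ab Bb t0; have [a [a' [m [m' [[al a'l aK aK'] [asa aE] [m'l mK mK' mE] Db DE]]]]] :=
  mobius_factor Ab Bb.
have aN x : nrm (a x) = graph_norm A x.
  by apply/eqP; rewrite -(@eqrXn2 _ 2) ?nrm_ge0 ?graph_norm_ge0 // -ipxx aE graph_norm_sqr.
have T0 := tanh_ge0 t0; have C0 := cosh_gt0 t; have TC := tanh_sqr t.
have T1 : 0 < 1 - tanh t ^+ 2 by rewrite subr_gt0 expr_lt1 // tanh_lt1.
split=> [/(opnorm_le Db T0) Dt x y|PC].
  pose z := a' (m y); have az : a z = m y by exact: aK'.
  have := Dt z; rewrite -ler_sqr ?nnegrE ?nrm_ge0 ?(mulr_ge0 T0) ?nrm_ge0 //.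
  rewrite DE az mK -graph_norm_sqr // exprMn => h.
  have zy : nrm z <= cosh t * graph_norm B y.
    rewrite -ler_sqr ?nnegrE ?nrm_ge0 ?(mulr_ge0 (ltW C0)) ?graph_norm_ge0 // exprMn.
    rewrite -(ler_pM2l T1) [X in _ <= X]mulrA TC; lra.
  rewrite -mE -az -asa; apply: le_trans (ip_le _ _) _; rewrite aN mulrCA.
  by rewrite ler_wpM2l ?graph_norm_ge0.
apply/(opnorm_le Db T0) => x; rewrite -ler_sqr ?nnegrE ?nrm_ge0 ?(mulr_ge0 T0) ?nrm_ge0 //.
rewrite DE -graph_norm_sqr // exprMn; set y := m' (a x).
have := PC (a' x) y; rewrite -mE mK' -asa aK' ipxx -(aN (a' x)) aK' => h.
have xy : nrm x <= cosh t * graph_norm B y.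
  have [<-|x0] := eqVneq 0 (nrm x); first by rewrite (mulr_ge0 (ltW C0)) ?graph_norm_ge0.
  rewrite -(@ler_pM2l _ (nrm x)) ?lt0r ?(eq_sym _ 0) ?x0 ?nrm_ge0 //.
  by rewrite -expr2; apply: le_trans h _; rewrite mulrCA.
have h3 : (1 - tanh t ^+ 2) * nrm x ^+ 2 <= (1 - tanh t ^+ 2) * (cosh t * graph_norm B y) ^+ 2.
  by rewrite ler_pM2l // ler_sqr ?nnegrE ?nrm_ge0 ?(mulr_ge0 (ltW C0)) ?graph_norm_ge0.
rewrite [(_ * graph_norm _ _) ^+ 2]exprMn [X in _ <= X]mulrA TC in h3; lra.
Qed.

Lemma opnorm_mobius_lt1 A B : operator_ball A -> operator_ball B ->
  0 <= opnorm (mobius (\- A) B) < 1.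
Proof.
move=> Ab Bb; have [c hc] := pairing_bound Ab Bb.
have [_ [_ [_ [_ [_ _ _ Db _]]]]] := mobius_factor Ab Bb.
rewrite opnorm_ge0 //=; have [t [t0 tE]] : exists t, 0 <= t /\ cosh t = 1 + `|c|.
  by apply: cosh_onto; rewrite lerDl.
apply: le_lt_trans (tanh_lt1 t); apply/opnorm_mobius => // x y.
apply: le_trans (hc x y) _; rewrite ler_wpM2r ?mulr_ge0 ?graph_norm_ge0 // tE.
by have := ler_norm c; lra.
Qed.

(** cosh (rho A B) is the supremum of the form on pairs of unit vectors of the two
    graphs. This is symmetric and invariant under isometries of the form, and it
    replaces the definition of rho from here on. *)
Lemma rho_leP A B t : operator_ball A -> operator_ball B -> 0 <= t ->
  rho A B <= t <-> forall x y, pairing A B x y <= cosh t * (graph_norm A x * graph_norm B y).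
Proof.
move=> Ab Bb t0; have /andP[N0 N1] := opnorm_mobius_lt1 Ab Bb.
by rewrite /rho atanh_le //; exact: opnorm_mobius.
Qed.

Lemma rho_ge0 A B : operator_ball A -> operator_ball B -> 0 <= rho A B.
Proof. by move=> Ab Bb; have /andP[N0 N1] := opnorm_mobius_lt1 Ab Bb; exact: atanh_ge0. Qed.

Lemma pairing_rho A B x y : operator_ball A -> operator_ball B ->
  pairing A B x y <= cosh (rho A B) * (graph_norm A x * graph_norm B y).
Proof. by move=> Ab Bb; apply: (rho_leP Ab Bb (rho_ge0 Ab Bb)).1. Qed.

(** At distance 0 the component of (y, B y) along the graph of A is no longer than
    (y, B y) itself, so the negative component vanishes. *)
Lemma rho_eq0 A B : operator_ball A -> operator_ball B -> rho A B <= 0 -> A = B.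
Proof.
move=> Ab Bb /(rho_leP Ab Bb (lexx 0)) h; apply/funext => y.
have Al := ball_linear Ab.
have [As [Asl adj [t [t0 t1 _ Ast]]]] := ball_adj Ab.
have [p [r [yE hE]]] := graph_split Ab adj Asl y (B y).
have c1 : cosh 0 = 1 :> R by rewrite /cosh oppr0 expR0; field.
have hp : pairing A B p y = pairing A A p p.
  by rewrite /pairing /krein hE {1}yE !ipDr (adj _ r); ring.
have := h p y; rewrite hp c1 mul1r -graph_norm_sqr // => gp.
have gpy : graph_norm A p <= graph_norm B y.
  have [<-|p0] := eqVneq 0 (graph_norm A p); first exact: graph_norm_ge0.
  by rewrite -(@ler_pM2l _ (graph_norm A p)) -?expr2 // lt0r eq_sym p0 graph_norm_ge0.
have : graph_norm A p ^+ 2 <= graph_norm B y ^+ 2 by rewrite ler_sqr ?nnegrE ?graph_norm_ge0.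
rewrite !graph_norm_sqr // => e.
have r0 : nrm r = 0.
  apply/eqP; rewrite -sqrf_eq0 eq_le sqr_ge0 andbT.
  move: e; rewrite {2}/pairing /krein hE yE !(ipDl, ipDr) (ipC r (A p)) (adj p r) (ipC (As r) p).
  rewrite /pairing /krein => e.
  have := Ast r; rewrite -ler_sqr ?nnegrE ?mulr_ge0 ?nrm_ge0 // exprMn -!ipxx => e2.
  have t2 : 0 < 1 - t ^+ 2 by rewrite subr_gt0 expr_lt1.
  rewrite -(pmulr_rle0 _ t2); lra.
have yp : y = p by rewrite {1}yE (nrm_eq0 r0) (lin0 Asl) addr0.
by rewrite hE (nrm_eq0 r0) addr0 yp.
Qed.

(** * Midpoints *)

(** The operator inequality s^2 <= s for a positive contraction, by
    Cauchy-Schwarz for the form of s. *)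
Lemma contraction_form (s : K -> K) v : (forall x y, ip (s x) y = ip x (s y)) ->
  linear s -> (forall x, 0 <= ip (s x) x) -> (forall x, nrm (s x) <= nrm x) ->
  nrm (s v) ^+ 2 <= ip (s v) v.
Proof.
move=> sa sl pos sc.
have := @quadratic_CS _ (ip (s v) v) (ip (s (s v)) (s v)) (ip (s v) (s v)) (pos _) (pos _).
move=> /(_ _)/wrap[r|].
  have := pos (remb r *: v + s v); rewrite (linD sl) (linZ sl) !(ipDl, ipDr, ipZl, ipZr).
  by rewrite (sa (s v) v); congr (_ <= _); ring.
rewrite ger0_norm ipxx ?sqr_ge0 // -sqrtrM // => h.
have h1 : ip (s (s v)) (s v) <= nrm (s v) ^+ 2.
  by apply: le_trans (ip_le _ _) _; rewrite expr2 ler_wpM2r ?nrm_ge0.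
have := sqr_ge0 (nrm (s v)); rewrite le_eqVlt => /orP[/eqP <-|n0]; first exact: pos.
rewrite -(ler_pM2r n0); set n := nrm (s v) ^+ 2 in h h1 n0 *.
have : n * n <= ip (s v) v * ip (s (s v)) (s v).
  by rewrite -expr2 -(sqr_sqrtr (mulr_ge0 (pos v) (pos (s v)))) ler_sqr ?nnegrE ?sqrtr_ge0 // ltW.
by move=> /le_trans; apply; rewrite ler_wpM2l.
Qed.

(** The isometry x |-> w x between the graphs of X and Y that will be induced by the
    reflection in their midpoint. After moving X to 0, Y becomes the Moebius
    transform D, and w is the inverse s' of the square root of 1 - D'D, with D' the
    adjoint of D; the maps a and m' bring this back to X and Y. Since s <= 1 the
    pairing of x with w x is at least the squared length of x. *)
Lemma midpoint_swap X Y : operator_ball X -> operator_ball Y ->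
  exists w : K -> K, [/\ linear w,
    forall x y, pairing Y Y (w x) (w y) = pairing X X x y,
    forall x y, pairing X Y x (w y) = pairing X Y y (w x) &
    forall x, pairing X X x x <= pairing X Y x (w x)].
Proof.
move=> Xb Yb; have [a [a' [m [m' [[al a'l aK aK'] [asa aE] [m'l mK mK' mE] Db DE]]]]] :=
  mobius_factor Xb Yb.
have /andP[N0 N1] := opnorm_mobius_lt1 Xb Yb.
set D := mobius _ _ in Db DE N0 N1.
have Dball : operator_ball D by [].
have Dl := ball_linear Dball.
have Dn := (opnorm_le Db N0).1 (lexx _); set t := opnorm D in N0 N1 Dn.
have Ds := ip_adj Dl; have Dsl := adjoint_linear Dl.
have Dsn := ip_adj_bound Dl N0 Dn Ds.
pose P := (fun x => x - adjoint D (D x)) : K -> K.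
have [] := @sqrt_opP _ _ _ P t _ _ N0 N1 _.
- by move=> b x y; rewrite /P Dl Dsl scalerBr; vec.
- by move=> x y; rewrite /P ipDl ipDr ipNl ipNr -Ds (ipC (adjoint _ _) y) -Ds (ipC (D y)).
- move=> x; rewrite /P opprB addrC subrK; apply: le_trans (Dsn _) _.
  by rewrite ler_wpM2l //; apply: le_trans (Dn _) _; rewrite ler_piMl ?nrm_ge0 // ltW.
set s := sqrt_op P => /positiveP [sl ssa sp] sE s'b sK sK'.
have [s'l _] := s'b; set s' := inv_op s in s'b sK sK' s'l.
have sq x : ip (s x) (s x) = nrm x ^+ 2 - nrm (D x) ^+ 2.
  by rewrite -ssa sE /P ipDl ipNl (ipC (adjoint _ _)) -Ds !ipxx.
have sc x : nrm (s x) <= nrm x.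
  rewrite -ler_sqr ?nnegrE ?nrm_ge0 // -ipxx sq; have := sqr_ge0 (nrm (D x)); lra.
have s'sa x y : ip (s' x) y = ip x (s' y) by rewrite -{1}(sK' y) -ssa sK'.
pose w x := m' (a (s' (a x))).
have wl : linear w by move=> b x y; rewrite /w al s'l al m'l.
have wq x : pairing Y Y (w x) (w x) = pairing X X x x.
  have := DE (s' (a x)); rewrite -/(w x) => e.
  have := sq (s' (a x)); rewrite sK' aE; lra.
have XYw x y : pairing X Y x (w y) = ip (a x) (s' (a y)).
  by rewrite -mE /w mK' -asa.
exists w; split=> // [x y|x y|x].
- have Xl := ball_linear Xb; have Yl := ball_linear Yb.
  have := wq (x + y); rewrite (linD wl) /pairing /krein (linD Xl) (linD Yl).
  have := wq x; have := wq y; rewrite /pairing /krein !(ipDl, ipDr).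
  rewrite (ipC (w y) (w x)) (ipC (Y (w y)) (Y (w x))) (ipC y x) (ipC (X y) (X x)); lra.
- by rewrite !XYw ipC s'sa.
rewrite XYw -aE -{1 2 3}(sK' (a x)) ipxx.
exact: contraction_form.
Qed.

(** The reflection fixing the graph of Z and negating its orthogonal complement is
    an isometry of the form, which exchanges the graphs of X and Y. A vector e of
    the graph of W and its reflection f satisfy [e, f] = 2 |z|^2 - [e, e], where z is
    the component of e along the graph of Z. The triangle inequality through X
    bounds [e, f] by cosh (rho X W + rho Y W) [e, e], which is the assertion up to
    the half-angle formula: W and its mirror image are at distance 2 rho Z W. *)
Lemma reflection_midpoint X Y Z (w : K -> K) : operator_ball X -> operator_ball Y ->
  operator_ball Z ->
  (forall x y, pairing Y Y (w x) (w y) = pairing X X x y) ->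
  (forall x y, pairing X Y x (w y) = pairing X Y y (w x)) ->
  (forall x, Z (x + w x) = X x + Y (w x)) -> (forall p, exists x, p = x + w x) ->
  is_midpoint X Y Z.
Proof.
move=> Xb Yb Zb wE wsym ZT surj; split=> // W Wb.
have A0 := rho_ge0 Xb Wb; have B0 := rho_ge0 Yb Wb.
have XWr x y := pairing_rho x y Xb Wb.
have YWr x y := pairing_rho x y Yb Wb.
move: (rho X W) (rho Y W) A0 B0 XWr YWr => al be A0 B0 XWr YWr.
apply/rho_leP => // [|x y]; first by rewrite divr_ge0 ?addr_ge0.
have [Zs [Zsl adj _]] := ball_adj Zb.
have [p [r [yE hE]]] := graph_split Zb adj Zsl y (W y).
have -> : pairing Z W x y = pairing Z Z x p.
  by rewrite /pairing /krein hE {1}yE !ipDr (adj x r); ring.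
apply: le_trans (pairing_CS _ _ Zb) _; rewrite mulrCA ler_wpM2l ?graph_norm_ge0 //.
pose u := p - Zs r; pose v := Z p - r.
have nW := graph_norm_sqr y Wb; have nW0 := graph_norm_ge0 W y.
have nZ := graph_norm_sqr p Zb; have nZ0 := graph_norm_ge0 Z p.
set n := graph_norm W y in nW nW0 *; set z := graph_norm Z p in nZ nZ0 *.
have ef : krein y (W y) u v = 2 * z ^+ 2 - n ^+ 2.
  rewrite nZ nW /pairing /krein /u /v hE yE !(ipDl, ipDr, ipNl, ipNr) (ipC r (Z p)) (adj p r).
  by rewrite (ipC (Zs r) p); ring.
have ff : krein u v u v = n ^+ 2.
  rewrite nW /pairing /krein /u /v hE yE !(ipDl, ipDr, ipNl, ipNr) (ipC r (Z p)) (adj p r).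
  by rewrite (ipC (Zs r) p); ring.
have ce q : krein q (X q) y (W y) <= cosh al * n * graph_norm X q.
  by apply: le_trans (XWr q y) _; rewrite -/n; lra.
have swap q : krein q (X q) u v = krein (w q) (Y (w q)) y (W y).
  have [s ps] := surj p.
  have -> : u = p + p - y by rewrite yE /u; vec.
  have -> : v = Z p + Z p - W y by rewrite hE /v; vec.
  have h1 : krein (q + w q) (Z (q + w q)) y (W y) = pairing Z Z (q + w q) p.
    by rewrite /pairing /krein hE {1}yE !ipDr (adj _ r); ring.
  move: h1 (wE q s) (wsym q s); rewrite ps /pairing !ZT /krein.
  rewrite !(ipDl, ipDr, ipNr) (ipC (w q) s) (ipC (Y (w q)) (X s)); lra.
have cf q : krein q (X q) u v <= cosh be * n * graph_norm X q.
  rewrite swap; apply: le_trans (YWr (w q) y) _; rewrite -/n /graph_norm wE; lra.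
have C1 := cosh_gt0 al; have C2 := cosh_gt0 be.
have := graph_triangle Xb (mulr_ge0 (ltW C1) nW0) (mulr_ge0 (ltW C2) nW0) ce cf.
have sq t : 0 <= t -> Num.sqrt ((cosh t * n) ^+ 2 - n ^+ 2) = sinh t * n.
  move=> t0; rewrite exprMn cosh_sinh mulrDl mul1r addrC addKr -exprMn sqrtr_sqr ger0_norm //.
  by rewrite mulr_ge0 ?sinh_ge0.
rewrite ef ff -/(pairing W W y y) -nW !sq // => h.
have h2 : 2 * z ^+ 2 <= 2 * (cosh ((al + be) / 2) * n) ^+ 2.
  rewrite [(_ * n) ^+ 2]exprMn [X in _ <= X]mulrA -cosh_half coshD; lra.
rewrite ler_pM2l // ler_sqr ?nnegrE // in h2.
by rewrite mulr_ge0 // ltW // cosh_gt0.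
Qed.

(** The graph of the midpoint consists of the sums of vectors of the graphs of X and
    Y matched by w. *)
Lemma midpoint_exists X Y : operator_ball X -> operator_ball Y ->
  exists (Z : K -> H) (w : K -> K), [/\ operator_ball Z, is_midpoint X Y Z,
    forall x, pairing Y Y (w x) (w x) = pairing X X x x,
    forall x, pairing X X x x <= pairing X Y x (w x) &
    (forall x, Z (x + w x) = X x + Y (w x)) /\ forall p, exists x, p = x + w x].
Proof.
move=> Xb Yb; have [w [wl wE wsym wge]] := midpoint_swap Xb Yb.
have Xl := ball_linear Xb; have Yl := ball_linear Yb.
have [c [c0 Xc]] := graph_norm_coercive Xb; have [d [d0 Yd]] := graph_norm_coercive Yb.
pose T x := x + w x.
have Tl : linear T by move=> a x y; rewrite /T wl scalerDr; vec.
have sumE x : krein (T x) (X x + Y (w x)) (T x) (X x + Y (w x)) =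
    2 * pairing X X x x + 2 * pairing X Y x (w x).
  have := wE x x; rewrite /T /pairing /krein !(ipDl, ipDr) (ipC (w x) x) (ipC (Y (w x)) (X x)); lra.
pose e := 1 + 1 / d.
have e0 : 0 < e by rewrite addr_gt0 ?divr_gt0.
have Xn x : graph_norm X x <= nrm x.
  rewrite -ler_sqr ?nnegrE ?nrm_ge0 ?graph_norm_ge0 // graph_norm_sqr // /pairing /krein !ipxx.
  by rewrite gerBl sqr_ge0.
have Tb x : nrm (T x) <= e * nrm x.
  apply: le_trans (nrmD _ _) _; rewrite mulrDl mul1r lerD2l mulrAC ler_pdivlMr // mul1r mulrC.
  by apply: le_trans (Yd _) _; rewrite /graph_norm wE; exact: Xn.
have low x : 4 * c ^+ 2 / e ^+ 2 * nrm (T x) ^+ 2 <=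
    krein (T x) (X x + Y (w x)) (T x) (X x + Y (w x)).
  have h1 : nrm (T x) ^+ 2 <= e ^+ 2 * nrm x ^+ 2.
    by rewrite -exprMn ler_sqr ?nnegrE ?mulr_ge0 ?nrm_ge0 // ltW.
  have h2 : c ^+ 2 * nrm x ^+ 2 <= pairing X X x x.
    rewrite -graph_norm_sqr // -exprMn ler_sqr ?nnegrE ?mulr_ge0 ?nrm_ge0 ?graph_norm_ge0 // ltW //.
  rewrite mulrAC ler_pdivrMr ?exprn_gt0 // sumE.
  have h3 := wge x.
  have h4 : 4 * c ^+ 2 * nrm (T x) ^+ 2 <= 4 * c ^+ 2 * (e ^+ 2 * nrm x ^+ 2).
    by rewrite ler_pM2l // mulr_gt0 ?exprn_gt0.
  have h5 : e ^+ 2 * (c ^+ 2 * nrm x ^+ 2) <= e ^+ 2 * pairing X X x x.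
    by rewrite ler_pM2l // exprn_gt0.
  have h6 : e ^+ 2 * pairing X X x x <= e ^+ 2 * pairing X Y x (w x).
    by rewrite ler_pM2l // exprn_gt0.
  lra.
have Tinj x : T x = 0 -> x = 0.
  move=> Tx0; apply: nrm_eq0; apply/eqP; rewrite -sqrf_eq0 eq_le sqr_ge0 andbT.
  have := sumE x; rewrite Tx0 /krein ip0l sub0r => h.
  have h2 : c ^+ 2 * nrm x ^+ 2 <= pairing X X x x.
    rewrite -graph_norm_sqr // -exprMn ler_sqr ?nnegrE ?mulr_ge0 ?nrm_ge0 ?graph_norm_ge0 // ltW //.
  have h3 := wge x; rewrite ipxx in h; have := sqr_ge0 (nrm (X x + Y (w x))).
  have cc : 0 < c ^+ 2 by rewrite exprn_gt0.
  by rewrite -(pmulr_rle0 _ cc); lra.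
have Tsurj p : exists x, p = T x.
  have Tm : linear T := Tl.
  pose TL : {linear K -> K} := HB.pack T (GRing.isLinear.Build _ _ _ _ T Tm).
  have k0 : lker (linfun TL) == 0%VS.
    apply/lker0P => x y; rewrite !lfunE /= => exy; apply/eqP; rewrite -subr_eq0; apply/eqP/Tinj.
    by rewrite (linB Tl) exy subrr.
  exists ((linfun TL)^-1%VF p).
  by have := lker0_lfunVK k0 p; rewrite lfunE.
have [T' hT'] := choice Tsurj.
have TK x : T' (T x) = x.
  apply/eqP; rewrite -subr_eq0; apply/eqP/Tinj; by rewrite (linB Tl) -hT' subrr.
pose Z p := X (T' p) + Y (w (T' p)).
have T'l : linear T'.
  move=> a x y; rewrite [in LHS](hT' x) [in LHS](hT' y) -Tl TK //.
have Zl : linear Z.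
  by move=> a x y; rewrite /Z T'l wl Xl Yl scalerDr; vec.
have ZT x : Z (T x) = X x + Y (w x) by rewrite /Z TK.
have Zb : operator_ball Z.
  apply: (@coercive_ball _ _ _ _ Z (4 * c ^+ 2 / e ^+ 2)) => // [|p].
    by rewrite divr_gt0 ?mulr_gt0 ?exprn_gt0.
  by rewrite (hT' p) /pairing ZT; exact: low.
have surj p : exists x, p = T x by exists (T' p); exact: hT'.
exists Z, w; split=> //; first exact: (reflection_midpoint Xb Yb Zb wE wsym ZT).
Qed.
End Rho.

(** * A midpoint is closer to far points *)

Section Closer.
Context {R : realType} {k : scalar_kind} {K : finHilbertType R k} {H : hilbertType R k}.
Implicit Types A B C W X Y Z : K -> H.

Lemma amgm_le (a b u v s t : R) : 0 <= a -> 0 <= b -> 0 <= u -> 0 <= v -> 0 <= s -> 0 <= t ->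
  a ^+ 2 <= s * u ^+ 2 -> b ^+ 2 <= t * v ^+ 2 -> a * b <= (s + t) / 2 * (u * v).
Proof.
move=> a0 b0 u0 v0 s0 t0 au bv.
have st : 0 <= (s + t) / 2 by rewrite divr_ge0 ?addr_ge0.
have ab0 : 0 <= a * b by exact: mulr_ge0.
have uv0 : 0 <= (s + t) / 2 * (u * v) by rewrite (mulr_ge0 st) // mulr_ge0.
rewrite -ler_sqr ?nnegrE // [X in X <= _]exprMn.
apply: le_trans (ler_pM (sqr_ge0 _) (sqr_ge0 _) au bv) _.
rewrite [X in _ <= X]exprMn [X in _ <= _ * X]exprMn mulrACA.
apply: ler_wpM2r; first by rewrite mulr_ge0 ?sqr_ge0.
have := sqr_ge0 (s - t); lra.
Qed.

(** The geometric heart. Suppose that X, Y and W are three far terms of a net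
    converging weakly to A, with g the limit of the squared lengths of the vectors
    of their graphs: then X, Y and W pair with each other almost as A with itself,
    and [pairing A A] <= q g. A unit vector of the graph of the midpoint is
    proportional to the sum of (x, X x) and (z, Y z) of the same length, whose
    pairing is at least their squared length. If A pairs nearly optimally with
    both, then x and z pair well with each other, and the sum is long. So the
    pairing of the midpoint with W is at most about (3q + 1)/4, while those
    of X and Y with W are only bounded by q. The term in dl collects the errors of
    the approximation. *)
Lemma midpoint_closer X Y Z W A (w : K -> K) (g : K -> R) (q c dl : R) :
  operator_ball X -> operator_ball Y -> operator_ball Z -> operator_ball W -> operator_ball A ->
  1 <= q -> 0 < c -> 0 <= dl -> dl <= 2^-1 ->
  (forall x, pairing Y Y (w x) (w x) = pairing X X x x) ->
  (forall x, pairing X X x x <= pairing X Y x (w x)) ->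
  (forall x, Z (x + w x) = X x + Y (w x)) -> (forall p, exists x, p = x + w x) ->
  (forall x, c * nrm x ^+ 2 <= g x) -> (forall x, pairing A A x x <= q * g x) ->
  (forall x, g x <= pairing X X x x + c * dl * nrm x ^+ 2) ->
  (forall x, g x <= pairing Y Y x x + c * dl * nrm x ^+ 2) ->
  (forall x, g x <= pairing W W x x + c * dl * nrm x ^+ 2) ->
  (forall x y, pairing A A x y <= pairing X Y x y + 2 * (c * dl * (nrm x * nrm y))) ->
  (forall x y, pairing X W x y <= pairing A A x y + 2 * (c * dl * (nrm x * nrm y))) ->
  (forall x y, pairing Y W x y <= pairing A A x y + 2 * (c * dl * (nrm x * nrm y))) ->
  forall p y, pairing Z W p y <= ((3 * q + 1) / 4 + (2 * q + 6) * dl) * (graph_norm Z p * graph_norm W y).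
Proof.
move=> Xb Yb Zb Wb Ab q1 c0 d0 d12 wE wge ZT surj cg Qg gX gY gW AXY XWA YWA p y.
have [x px] := surj p; pose z := w x.
have Al := ball_linear Ab.
have nZ : graph_norm Z p ^+ 2 = 2 * pairing X X x x + 2 * pairing X Y x z.
  rewrite graph_norm_sqr // px /pairing ZT /krein !(ipDl, ipDr) (ipC (w x) x) (ipC (Y (w x)) (X x)).
  by have := wE x; rewrite /pairing /krein /z; lra.
have nW := graph_norm_sqr y Wb.
have nZ0 := graph_norm_ge0 Z p; have nW0 := graph_norm_ge0 W y.
move: nZ nW nZ0 nW0; set nZ := graph_norm Z p; set nW := graph_norm W y => nZE nWE nZ0 nW0.
have gam := wge x; have wx := wE x; rewrite -/z in gam wx.
have gx := gX x; have gz := gY z; have gy := gW y.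
have cx := cg x; have cz := cg z; have cy := cg y.
have half (a b : R) : 0 <= a -> b <= 2^-1 -> a * b <= a / 2.
  by move=> a0 b0; rewrite ler_wpM2l.
have n2 (V : hilbertType R k) (v : V) : 0 <= nrm v ^+ 2 by exact: sqr_ge0.
have hx := half _ _ (mulr_ge0 (ltW c0) (n2 _ x)) d12.
have hz := half _ _ (mulr_ge0 (ltW c0) (n2 _ z)) d12.
have hy := half _ _ (mulr_ge0 (ltW c0) (n2 _ y)) d12.
set gx0 := pairing X X x x in nZE gam wx gx.
set ga := pairing X Y x z in nZE gam.
set nx := nrm x in gx cx hx *; set nz := nrm z in gz cz hz *; set ny := nrm y in gy cy hy *.
have nx0 : 0 <= nx by exact: nrm_ge0.
have nz0 : 0 <= nz by exact: nrm_ge0.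
have ny0 : 0 <= ny by exact: nrm_ge0.
rewrite wx in gz.
have bx : c * nx ^+ 2 <= 2 * gx0 by lra.
have bz : c * nz ^+ 2 <= 2 * gx0 by lra.
have byy : c * ny ^+ 2 <= 2 * nW ^+ 2 by rewrite nWE; lra.
have dx : c * nx ^+ 2 * dl <= 2 * gx0 * dl by rewrite ler_wpM2r.
have dz : c * nz ^+ 2 * dl <= 2 * gx0 * dl by rewrite ler_wpM2r.
have dy : c * ny ^+ 2 * dl <= 2 * nW ^+ 2 * dl by rewrite ler_wpM2r.
have q0 : 0 <= q by lra.
have gx00 : 0 <= gx0 by exact: pairing_ge0.
(* the term (q - 1) (ga - gx0) >= 0 is the gain over the trivial bound q *)
have Qp : pairing A A p p <= ((q + 1) / 2 + (2 * q + 4) * dl) * nZ ^+ 2.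
  have h1 := Qg x; have h2 := Qg z; have h3 := AXY x z.
  rewrite -/ga -/nx -/nz in h3.
  have -> : pairing A A p p = pairing A A x x + pairing A A z z + 2 * pairing A A x z.
    rewrite px /pairing (linD Al) /krein -/z !(ipDl, ipDr) (ipC z x) (ipC (A z) (A x)); ring.
  have h4 : q * g x <= q * (gx0 + 2 * gx0 * dl) by rewrite ler_wpM2l //; lra.
  have h5 : q * g z <= q * (gx0 + 2 * gx0 * dl) by rewrite ler_wpM2l //; lra.
  have h6 : c * dl * (nx * nz) <= 2 * gx0 * dl.
    have h : c * dl * (nx * nz) <= c * dl * ((nx ^+ 2 + nz ^+ 2) / 2).
      by rewrite ler_wpM2l ?mulr_ge0 ?(ltW c0) //; have := sqr_ge0 (nx - nz); lra.
    lra.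
  have h7 : 0 <= (q - 1) * (ga - gx0) by apply: mulr_ge0; rewrite subr_ge0.
  have h8 : 0 <= (2 * q + 4) * dl * ga.
    by apply: mulr_ge0; [apply: mulr_ge0 => //; lra | exact: le_trans gam].
  rewrite nZE; lra.
have Qy : pairing A A y y <= q * (1 + 2 * dl) * nW ^+ 2.
  have h1 := Qg y.
  have h4 : q * g y <= q * (nW ^+ 2 + 2 * nW ^+ 2 * dl) by rewrite ler_wpM2l //; rewrite nWE in dy *; lra.
  lra.
have main : pairing A A p y <= ((3 * q + 1) / 4 + (2 * q + 2) * dl) * (nZ * nW).
  apply: le_trans (pairing_CS _ _ Ab) _.
  have -> : (3 * q + 1) / 4 + (2 * q + 2) * dl =
     (((q + 1) / 2 + (2 * q + 4) * dl) + q * (1 + 2 * dl)) / 2 by field.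
  have s0 : 0 <= (q + 1) / 2 + (2 * q + 4) * dl.
    have : 0 <= (2 * q + 4) * dl by apply: mulr_ge0 => //; lra.
    lra.
  have t0 : 0 <= q * (1 + 2 * dl) by apply: mulr_ge0 => //; lra.
  apply: amgm_le => //; try exact: graph_norm_ge0.
    by rewrite (graph_norm_sqr p Ab).
  by rewrite (graph_norm_sqr y Ab).
have err v : c * v ^+ 2 <= 2 * gx0 -> 0 <= v -> c * dl * (v * ny) <= dl * (nZ * nW).
  move=> cv v0; rewrite mulrAC mulrC ler_wpM2l // -ler_sqr ?nnegrE ?mulr_ge0 ?(ltW c0) //.
  have -> : (c * (v * ny)) ^+ 2 = (c * v ^+ 2) * (c * ny ^+ 2) by ring.
  rewrite exprMn.
  have h1 : c * v ^+ 2 <= nZ ^+ 2 / 2 by rewrite nZE; lra.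
  have : (c * v ^+ 2) * (c * ny ^+ 2) <= nZ ^+ 2 / 2 * (2 * nW ^+ 2).
    by apply: ler_pM => //; rewrite mulr_ge0 ?sqr_ge0 // ltW.
  lra.
have e1 := err nx bx nx0; have e2 := err nz bz nz0.
have -> : pairing Z W p y = pairing X W x y + pairing Y W z y.
  by rewrite px /pairing ZT /krein -/z !ipDl; ring.
have := XWA x y; have := YWA z y; rewrite -/nx -/nz -/ny => h1 h2.
have h3 : pairing A A p y = pairing A A x y + pairing A A z y.
  by rewrite px /pairing (linD Al) /krein -/z !ipDl; ring.
rewrite h3 in main; lra.
Qed.
End Closer.

(** * Limits along ultrafilters *)

Section Limits.
Context {R : realType} {k : scalar_kind} {K : finHilbertType R k} {H : hilbertType R k}.
Local Notation F := (scalar_field R k).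
Implicit Types A B C W X Y Z : K -> H.

Lemma ultra_bounded_cvg (T : Type) (U : set_system T) (f : T -> R) (c : R) :
  UltraFilter U -> (\forall x \near U, `|f x| <= c) -> exists l : R, f x @[x --> U] --> l.
Proof.
move=> UU fc.
have [l [_ lU]] : `[- c, c] `&` cluster (f @ U) !=set0.
  apply: segment_compact; rewrite /fmap /=; apply: filterS fc => x /=.
  by rewrite in_itv /= ler_norml.
exists l; apply/cvgrPdist_lt => e e0.
have [//|/= nU] := in_ultra_setVsetC [set x | `|l - f x| < e] UU.
have [] := lU (~` ball l e) (ball l e).
- by rewrite /fmap /=; move: nU; apply: filterS => x /=; rewrite -ball_normE.
- exact: nbhsx_ballx.
by move=> y [].
Qed.

Lemma wot_cvg (U : set_system (K -> H)) A (x : K) (y : H) : Filter U ->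
  (U : set_system (weak_operator_topology K H)) --> (A : weak_operator_topology K H) ->
  (fun X => ip (X x) y) @ U --> ip (A x) y.
Proof.
move=> UF UA.
have c1 : (fun X : weak_operator_topology K H => inner (X x) y) @ U --> inner (A x) y.
  have cont : continuous (fun X : weak_operator_topology K H => inner (X x) y).
    move=> B; apply: (continuous_comp (f := (@matrix_coefficients R k K H : weak_operator_topology K H -> _))
      (g := fun h : {ptws K * H -> F} => h (x, y))).
      exact: initial_continuous.
    exact: (@proj_continuous _ (fun=> F) (x, y)).
  exact: cvg_trans (cvg_app _ UA) (cont A).
apply/cvgrPdist_lt => e e0.
have e0' : 0 < remb e :> F by rewrite -remb0 ltr_remb.
move/cvgrPdist_lt: c1 => /(_ _ e0'); apply: filterS => X /= h.
rewrite /ip -sreN -sreD; apply: le_lt_trans (sre_le_norm _) _.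
by rewrite -(@ltr_remb R k) sreK.
Qed.

Lemma cvg_sum_seq (T I : Type) (U : set_system T) (f : I -> T -> R) (s : seq I) : Filter U ->
  (forall i, f i x @[x --> U] --> (0 : R)) ->
  (fun x => \sum_(i <- s) f i x) @ U --> (0 : R).
Proof.
move=> UF fi; elim: s => [|i s IH].
  by under eq_fun do rewrite big_nil; exact: cvg_cst.
under eq_fun do rewrite big_cons.
by have h := cvgD (fi i) IH; rewrite addr0 in h; exact: h.
Qed.

Definition real_bilinear (B : K -> K -> R) : Prop :=
  [/\ forall x y z, B (x + y) z = B x z + B y z,
   forall r x z, B (remb r *: x) z = r * B x z,
   forall x y z, B z (x + y) = B z x + B z y &
   forall r x z, B z (remb r *: x) = r * B z x].

(** Bilinear forms on a finite-dimensional space converge uniformly on bounded sets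
    as soon as they converge on the pairs of vectors of one fixed finite list. *)
Lemma uniform_cvg (T : Type) (U : set_system T) (B : T -> K -> K -> R) e : Filter U ->
  (\forall t \near U, real_bilinear (B t)) ->
  (forall x y, B t x y @[t --> U] --> (0 : R)) -> 0 < e ->
  \forall t \near U, forall x y, `|B t x y| <= e * (nrm x * nrm y).
Proof.
move=> UF Bl B0 e0; have [s hs] := @bilinear_bound R k K.
have : (fun t => \sum_(u <- s) \sum_(v <- s) `|B t u v|) @ U --> (0 : R).
  apply: cvg_sum_seq => u; apply: cvg_sum_seq => v.
  by rewrite -(normr0 R); apply: cvg_norm; exact: B0.
move/cvgrPdist_lt => /(_ e e0) near0.
apply: filterS2 Bl near0 => t [b1 b2 b3 b4] /=; rewrite sub0r normrN => /ltr_normlW h x y.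
apply: le_trans (hs _ b1 b2 b3 b4 x y) _.
by rewrite ler_wpM2r ?mulr_ge0 ?nrm_ge0 // ltW.
Qed.

Lemma ip_bilinear (L L' : K -> H) : linear L -> linear L' ->
  real_bilinear (fun x y => ip (L x) (L' y)).
Proof.
by move=> Ll L'l; split=> *; rewrite ?(linD Ll) ?(linD L'l) ?(linZ Ll) ?(linZ L'l)
  ?ipDl ?ipDr ?ipZl ?ipZr.
Qed.

Lemma bilinear_sub (B B' : K -> K -> R) : real_bilinear B -> real_bilinear B' ->
  real_bilinear (fun x y => B x y - B' x y).
Proof.
by move=> [a1 a2 a3 a4] [b1 b2 b3 b4]; split=> *; rewrite ?(a1,a2,a3,a4,b1,b2,b3,b4); ring.
Qed.

Lemma bilinear_lim (T : Type) (U : set_system T) (B : T -> K -> K -> R) (N : K -> K -> R) :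
  ProperFilter U -> (\forall t \near U, real_bilinear (B t)) ->
  (forall x y, B t x y @[t --> U] --> N x y) -> real_bilinear N.
Proof.
move=> UF Bl BN.
have u (f g : T -> R) (a b : R) : (\forall t \near U, f t = g t) ->
    f @ U --> a -> g @ U --> b -> a = b.
  move=> fg fa gb; apply: (@cvg_unique _ (@norm_hausdorff _ R) (f @ U) _ a b fa).
  by apply: cvg_trans gb; apply: near_eq_cvg; apply: filterS fg.
split=> [x y z|r x z|x y z|r x z].
- apply: u (BN _ _) (cvgD (BN x z) (BN y z)).
  by apply: filterS Bl => t [->].
- apply: u (BN _ _) (cvgM (cvg_cst r) (BN x z)).
  by apply: filterS Bl => t [_ ->].
- apply: u (BN _ _) (cvgD (BN z x) (BN z y)).
  by apply: filterS Bl => t [_ _ ->].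
apply: u (BN _ _) (cvgM (cvg_cst r) (BN z x)).
by apply: filterS Bl => t [_ _ _ ->].
Qed.
End Limits.

(** * Non-diametral points *)

Section Main.
Context {R : realType} {k : scalar_kind} {K : finHilbertType R k} {H : hilbertType R k}.
Implicit Types A B C W X Y Z : K -> H.

(** Midpoints make the sets of points of M almost at distance d from Z, for Z in M,
    into a filter base: a point far from a midpoint is far from both ends. Refine it
    to an ultrafilter U; by compactness U converges weakly to some A in M, and the
    finitely many coefficients of the squared lengths converge as well. For X and
    Y chosen U-close to A, [midpoint_closer] bounds the distance from their midpoint
    Z to every point of a set of U by a constant smaller than d, although Z is in M
    and U was built to be at distance d from every point of M. *)
Lemma not_all_diametral (M : set (K -> H)) (d : R) : m_set M -> 0 < d -> M !=set0 ->
  (forall X Y, M X -> M Y -> rho X Y <= d) ->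
  ~ (forall Z e, M Z -> 0 < e -> exists2 X, M X & d - e < rho Z X).
Proof.
move=> [Mball Mmid Mcomp] d0 [A0 MA0] dle dsup.
pose q := cosh d; have q1 : 1 < q by exact: cosh_gt1.
pose D := [set p : (K -> H) * R | M p.1 /\ 0 < p.2].
pose far (p : (K -> H) * R) := [set X | M X /\ d - p.2 < rho p.1 X].
have FF : Filter (filter_from D far).
  apply: filter_from_filter; first by exists (A0, 1); split.
  move=> [X e] [Y e'] /= [MX e0] [MY e0'].
  have [Z [w [Zb Zmid _ _ _]]] := midpoint_exists (Mball _ MX) (Mball _ MY).
  exists (Z, Num.min e e' / 2).
    split; first exact: Mmid Zmid.
    by rewrite /= divr_gt0 // lt_min e0.
  move=> W [/= MW ZW].
  have hz := Zmid.2 W (Mball _ MW); have hx := dle _ _ MX MW; have hy := dle _ _ MY MW.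
  have m1 : Num.min e e' <= e by rewrite ge_min lexx.
  have m2 : Num.min e e' <= e' by rewrite ge_min lexx orbT.
  suff [] : d - e < rho X W /\ d - e' < rho Y W by [].
  move: (rho X W) (rho Y W) (rho Z W) (Num.min e e') hz hx hy ZW m1 m2 => a b f m *.
  by split; lra.
have FP : ProperFilter (filter_from D far).
  apply: filter_from_proper => // -[Z e] [/= MZ e0].
  by have [X MX ZX] := dsup Z e MZ e0; exists X.
have [U [UU FU]] := ultraFilterLemma FP.
have Ufar Z e : M Z -> 0 < e -> \forall X \near U, M X /\ d - e < rho Z X.
  by move=> MZ e0; apply: FU; exists (Z, e).
have UM : U M by apply: filterS (Ufar A0 1 MA0 ltr01) => X [].
rewrite compact_ultra in Mcomp; have [A [MA UA]] := Mcomp U UU UM.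
have Ab := Mball _ MA; have Al := ball_linear Ab.
have UP : ProperFilter U := @ultra_proper _ _ UU.
have small X x : operator_ball X -> nrm (X x) <= nrm x.
  case/ballP => _ [t [t0 t1 Xt]]; apply: le_trans (Xt x) _.
  by rewrite ler_piMl ?nrm_ge0 // ltW.
have ex_N (p : K * K) : exists l : R, ip (X p.1) (X p.2) @[X --> U] --> l.
  apply: (@ultra_bounded_cvg _ _ _ _ (nrm p.1 * nrm p.2)).
  apply: filterS UM => X /Mball Xb; apply: le_trans (ip_norm _ _) _.
  by apply: ler_pM; rewrite ?nrm_ge0 ?small.
have [N0 hN0] := choice ex_N; pose N x y := N0 (x, y).
have hN x y : ip (X x) (X y) @[X --> U] --> N x y by exact: hN0 (x, y).
have nearlin : \forall X \near U, real_bilinear (fun x y => ip (X x) (X y)).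
  by apply: filterS UM => X /Mball/ball_linear Xl; exact: ip_bilinear.
have Nl : real_bilinear N := bilinear_lim UP nearlin hN.
have cvg0 (f : (K -> H) -> R) (a : R) : f @ U --> a -> (fun X => f X - a) @ U --> (0 : R).
  by move=> fa; rewrite -(subrr a); apply: cvgB => //; exact: cvg_cst.
have nearN e : 0 < e -> \forall X \near U,
    forall x y, `|ip (X x) (X y) - N x y| <= e * (nrm x * nrm y).
  apply: uniform_cvg; last by move=> x y; apply: cvg0; exact: hN.
  by apply: filterS nearlin => X Xl; exact: bilinear_sub.
have nearC C e : linear C -> 0 < e -> \forall X \near U,
    forall x y, `|ip (X x) (C y) - ip (A x) (C y)| <= e * (nrm x * nrm y).
  move=> Cl; apply: uniform_cvg; last by move=> x y; apply: cvg0; exact: wot_cvg.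
  by apply: filterS UM => X /Mball/ball_linear Xl; apply: bilinear_sub; exact: ip_bilinear.
pose g x := ip x x - N x x.
have Qg x : pairing A A x x <= q * g x.
  apply/ler_addgt0Pr => e e0.
  pose n := nrm x ^+ 2 + 1; have n0 : 0 < n by rewrite ltr_wpDl ?sqr_ge0.
  (* e' is scaled so that the errors, at most (q + 2) e' |x|^2, sum up to e *)
  pose e' := e / ((q + 2) * n).
  have qn : 0 < (q + 2) * n by rewrite mulr_gt0 //; lra.
  have e0' : 0 < e' by rewrite divr_gt0.
  have [X [[MX XN] XA]] := filter_ex (filterI (filterI UM (nearN e' e0')) (nearC A e' Al e0')).
  have Xb := Mball _ MX; have Xl := ball_linear Xb.
  have [Y [[MY YN] YX]] := filter_ex (filterI (filterI UM (nearN e' e0')) (nearC X e' Xl e0')).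
  have Yb := Mball _ MY.
  have h1 := pairing_rho x x Xb Yb.
  have h2 : cosh (rho X Y) <= q by apply: cosh_le (dle _ _ MX MY); exact: rho_ge0.
  have h3 : graph_norm X x * graph_norm Y x <= (pairing X X x x + pairing Y Y x x) / 2.
    by rewrite -!graph_norm_sqr //; have := sqr_ge0 (graph_norm X x - graph_norm Y x); lra.
  have h4 : cosh (rho X Y) * (graph_norm X x * graph_norm Y x) <=
      q * ((pairing X X x x + pairing Y Y x x) / 2).
    apply: ler_pM h2 h3; first exact: ltW (cosh_gt0 _).
    exact: mulr_ge0 (graph_norm_ge0 _ _) (graph_norm_ge0 _ _).
  have := XN x x; have := YN x x; have := XA x x; have := YX x x.
  rewrite !ler_norml => /andP[a1 a2] /andP[b1 b2] /andP[c1 c2] /andP[d1 d2].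
  have E : e = (q + 2) * (e' * nrm x ^+ 2) + (q + 2) * e'.
    by rewrite /e' /n; field; rewrite /n in n0; rewrite !gt_eqF //; lra.
  rewrite -expr2 in a1 a2 b1 b2 c1 c2 d1 d2; set f := e' * nrm x ^+ 2 in E a1 a2 b1 b2 c1 c2 d1 d2.
  move: h1 h4; rewrite /pairing /krein (ipC (Y x) (X x)) (ipC (A x) (X x)) in a1 a2 *.
  have q0 : 0 <= q * f by rewrite mulr_ge0 ?(mulr_ge0 (ltW e0')) ?sqr_ge0 //; lra.
  have qe : 0 <= (q + 2) * e' by rewrite mulr_ge0 // ?ltW //; lra.
  have k1 : q * ip (X x) (X x) >= q * (N x x - f) by rewrite ler_wpM2l //; lra.
  have k2 : q * ip (Y x) (Y x) >= q * (N x x - f) by rewrite ler_wpM2l //; lra.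
  move=> k3 k4; have k5 := le_trans k3 k4; rewrite /g; lra.
have [c1 [c10 cA]] := ball_coercive Ab.
pose c := c1 / q; have c0 : 0 < c by rewrite divr_gt0 //; lra.
have cg x : c * nrm x ^+ 2 <= g x.
  rewrite /c mulrAC ler_pdivrMr; last lra.
  by rewrite [g x * q]mulrC; apply: le_trans (Qg x).
(* chosen so that the bound of midpoint_closer becomes (7q + 1)/8, which is below q *)
pose dl := (q - 1) / (8 * (2 * q + 6)).
have dl0 : 0 < dl by rewrite divr_gt0 //; lra.
have dlE : (2 * q + 6) * dl = (q - 1) / 8 by rewrite /dl; field; lra.
have dl2 : dl <= 2^-1 by rewrite /dl ler_pdivrMr; lra.
have e0 : 0 < c * dl by exact: mulr_gt0.
have [X [[MX XN] XA]] := filter_ex (filterI (filterI UM (nearN _ e0)) (nearC A _ Al e0)).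
have Xb := Mball _ MX; have Xl := ball_linear Xb.
have [Y [[[MY YN] YA] YX]] := filter_ex (filterI (filterI (filterI UM (nearN _ e0)) (nearC A _ Al e0)) (nearC X _ Xl e0)).
have Yb := Mball _ MY; have Yl := ball_linear Yb.
have [Z [w [Zb Zmid wE wge [ZT surj]]]] := midpoint_exists Xb Yb.
have MZ := Mmid _ _ _ MX MY Zmid.
have [t0 [t00 t0E]] : exists t, 0 <= t /\ cosh t = (7 * q + 1) / 8.
  by apply: cosh_onto; lra.
have t0d : t0 < d.
  rewrite ltNge; apply/negP => dt; have := cosh_le (ltW d0) dt; rewrite t0E -/q; lra.
have dt0 : 0 < d - t0 by lra.
have [W [[[[MW ZW] WN] WX] WY]] := filter_ex (filterI (filterI (filterI (Ufar Z _ MZ dt0)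
   (nearN _ e0)) (nearC X _ Xl e0)) (nearC Y _ Yl e0)).
have Wb := Mball _ MW.
have : rho Z W <= t0; last by rewrite leNgt; move: ZW; rewrite opprB addrCA subrr addr0 => ->.
apply/rho_leP => // p y.
have -> : cosh t0 = (3 * q + 1) / 4 + (2 * q + 6) * dl by rewrite dlE t0E; field.
have gV V : (forall x y, `|ip (V x) (V y) - N x y| <= c * dl * (nrm x * nrm y)) ->
    forall x, g x <= pairing V V x x + c * dl * nrm x ^+ 2.
  move=> h x; have := h x x; rewrite ler_norml -expr2 => /andP[h1 h2].
  by rewrite /g /pairing /krein; lra.
apply: (@midpoint_closer _ _ _ _ X Y Z W A w g q c dl) => //; rewrite ?(ltW dl0) ?(ltW q1) //.
- exact: gV.
- exact: gV.
- exact: gV.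
- move=> x z; have := YX z x; have := XA x z; rewrite !ler_norml => /andP[a1 a2] /andP[b1 b2].
  rewrite (ipC (Y z)) (ipC (A z)) (mulrC (nrm z)) in b1 b2.
  by rewrite /pairing /krein; lra.
- move=> x z; have := WX z x; have := XA x z; rewrite !ler_norml => /andP[a1 a2] /andP[b1 b2].
  rewrite (ipC (W z)) (ipC (A z)) (mulrC (nrm z)) in b1 b2.
  by rewrite /pairing /krein; lra.
move=> x z; have := WY z x; have := YA x z; rewrite !ler_norml => /andP[a1 a2] /andP[b1 b2].
rewrite (ipC (W z)) (ipC (A z)) (mulrC (nrm z)) in b1 b2.
by rewrite /pairing /krein; lra.
Qed.
End Main.

Theorem theorem3p8 (R : realType) (k : scalar_kind)
    (K : finHilbertType R k) (H : hilbertType R k) (M : set (K -> H)) :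
  m_set M -> M !=set0 ->
  (exists A, M = [set A]) \/ (exists A, non_diametral M A).
Proof.
move=> Mm M0; apply: contrapT => /not_orP [single nondiam].
have dia A : M A -> diametral M A.
  by move=> MA; apply: contrapT => nd; apply: nondiam; exists A.
have [A MA] := M0; have [bM _ _] := dia _ MA.
have [Mball _ _] := Mm.
have [r hr] := bM.
pose S := [set rho p.1 p.2 | p in M `*` M].
have dle X Y : M X -> M Y -> rho X Y <= diam M.
  move=> MX MY; apply: ub_le_sup; last by exists (X, Y).
  by exists r => _ [[X' Y'] [/= MX' MY'] <-]; exact: hr.
apply: (@not_all_diametral _ _ _ _ M (diam M)) => // [|Z e MZ e0].
  rewrite ltNge; apply/negP => d0; apply: single; exists A; apply/seteqP; split=> [X MX|_ -> //].
  apply/esym/(rho_eq0 (Mball _ MA) (Mball _ MX)).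
  exact: le_trans (dle _ _ MA MX) d0.
have [_ _ supE] := dia _ MZ.
have [] := @sup_adherent _ [set rho Z X | X in M] e e0.
  split; first by exists (rho Z A); exists A.
  by exists r => _ [X MX <-]; exact: hr.
by move=> _ [X MX <-]; rewrite supE => h; exists X.
Qed.
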